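(* Let $d\ge2$ and let $\theta$ be a real skew-symmetric $d\times d$ matrix. Then $$\mathrm{M}_{\mathrm{cb}}(\mathbb{T}^d_\theta)=\mathrm{M}_{\mathrm{cb}}(L_\infty(\mathbb{T}^d))=\mathrm{M}(L_\infty(\mathbb{T}^d))\quad\text{with equal norms,}$$ where $\mathrm{M}_{\mathrm{cb}}(\mathbb{T}^d_\theta)$ denotes $\mathrm{M}_{\mathrm{cb}}(L_\infty(\mathbb{T}^d_\theta))$.
   Context: Quantum torus. $\mathcal{A}_\theta$ is the universal $C^*$-algebra generated by $d$ unitaries $U_1,\dots,U_d$ with $U_kU_j=e^{2\pi \mathrm{i}\theta_{kj}}U_jU_k$. For $m\in\mathbb{Z}^d$ put $U^m=U_1^{m_1}\cdots U_d^{m_d}$. A polynomial is a finite sum $\sum_m\alpha_mU^m$; $\mathcal{P}_\theta$ is the algebra of polynomials. The functional $\tau(\sum_m\alpha_mU^m)=\alpha_{\mathbf 0}$ extends to a faithful tracial state on $\mathcal{A}_\theta$; $\mathbb{T}^d_\theta=L_\infty(\mathbb{T}^d_\theta)$ is the $w^*$-closure of $\mathcal{A}_\theta$ in the GNS representation of $\tau$; $\hat x(m)=\tau((U^m)^*x)$. When $\theta=0$, $\mathbb{T}^d_\theta=L_\infty(\mathbb{T}^d)$. Multipliers. For $\phi=(\phi_m)_{m\in\mathbb{Z}^d}\subset\mathbb{C}$ define $T_\phi$ on $\mathcal{P}_\theta$ by $\widehat{T_\phi x}(m)=\phi_m\hat x(m)$. $\phi$ is a bounded (resp. completely bounded) $L_\infty$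 multiplier on $\mathbb{T}^d_\theta$ if $T_\phi$ extends to a ($w^*$-continuous) bounded (resp. completely bounded) map on $\mathbb{T}^d_\theta$; the space of these $\phi$, with the norm $\|T_\phi\|$ (resp. $\|T_\phi\|_{\mathrm{cb}}$), is $\mathrm{M}(L_\infty(\mathbb{T}^d_\theta))$ (resp. $\mathrm{M}_{\mathrm{cb}}(L_\infty(\mathbb{T}^d_\theta))$). Complete boundedness refers to the operator space structure of a von Neumann algebra: $\|u\|_{\mathrm{cb}}=\sup_n\|\mathrm{id}_{\mathbb{M}_n}\otimes u\|$. *)

(* Defs.v *)
From HB Require Import structures.
From mathcomp Require Import all_boot all_order all_algebra.
From mathcomp Require Import all_classical all_reals all_analysis.
From mathcomp Require Import complex ring lra.

Set Implicit Arguments.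
Unset Strict Implicit.
Unset Printing Implicit Defensive.

Import Order.TTheory GRing.Theory Num.Theory.
Import numFieldNormedType.Exports.

Local Open Scope classical_set_scope.
Local Open Scope ring_scope.
Local Open Scope complex_scope.

Section ComplexSums.
Variable R : realType.
Implicit Types z w : R[i].

Definition normsq z : R := complex.Re z ^+ 2 + complex.Im z ^+ 2.

Definition expi (t : R) : R[i] := cos t +i* sin t.

(* Unordered sums; as for the Lebesgue integral, they are meaningful for
   absolutely summable families only. *)
Definition rsum (J : choiceType) (f : J -> R) : R :=
  fine (\esum_(j in [set: J]) (Num.max (f j) 0)%:E
        - \esum_(j in [set: J]) (Num.max (- f j) 0)%:E)%E.

Definition csum (J : choiceType) (f : J -> R[i]) : R[i] :=
  rsum (fun j => complex.Re (f j)) +i* rsum (fun j => complex.Im (f j)).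

Lemma normsq_ge0 z : 0 <= normsq z.
Proof. by rewrite addr_ge0// sqr_ge0. Qed.

Lemma normsqM z w : normsq (z * w) = normsq z * normsq w.
Proof.
case: z w => [a b] [c e]; rewrite /normsq/=.
by ring.
Qed.

Lemma normsqD_le z w : normsq (z + w) <= 2 * normsq z + 2 * normsq w.
Proof.
case: z w => [a b] [c e]; rewrite /normsq/= -subr_ge0.
suff -> : 2 * (a ^+ 2 + b ^+ 2) + 2 * (c ^+ 2 + e ^+ 2) -
    ((a + c) ^+ 2 + (b + e) ^+ 2) = (a - c) ^+ 2 + (b - e) ^+ 2.
  by rewrite addr_ge0// sqr_ge0.
by ring.
Qed.

Lemma normsq_expi t : normsq (expi t) = 1.
Proof. by rewrite /normsq/= cos2Dsin2. Qed.

Lemma expiD s t : expi (s + t) = expi s * expi t.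
Proof.
by rewrite /expi cosD sinD /GRing.mul/=; congr (_ +i* _); rewrite addrC.
Qed.

Lemma expi0 : expi 0 = 1.
Proof. by rewrite /expi cos0 sin0. Qed.

End ComplexSums.

Section HilbertSpace.
Variables (R : realType) (J : choiceType).

Definition sqsum (xi : J -> R[i]) : \bar R :=
  \esum_(j in [set: J]) (normsq (xi j))%:E.

Definition square_summable : {pred J -> R[i]} :=
  fun xi => `[< (sqsum xi < +oo)%E >].

Lemma square_summableP xi :
  reflect (sqsum xi < +oo)%E (xi \in square_summable).
Proof. exact: asboolP. Qed.

Lemma square_summable_submod : submod_closed square_summable.
Proof.
split.
  apply/square_summableP; rewrite /sqsum esum1 ?ltry// => j _.
  by rewrite /normsq/= expr0n/= addr0.
move=> a xi eta /square_summableP xioo /square_summableP etaoo.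
apply/square_summableP.
have normsq0 z : (0 <= (normsq z)%:E :> \bar R)%E by rewrite lee_fin normsq_ge0.
have scaled (c : R) f : 0 <= c -> (forall j, 0 <= f j) ->
    (\esum_(j in [set: J]) (f j)%:E < +oo)%E ->
    (\esum_(j in [set: J]) (c * f j)%:E < +oo)%E.
  move=> c0 f0 foo; apply: (@le_lt_trans _ _
      (c%:E * \esum_(j in [set: J]) (f j)%:E)%E); last first.
    by rewrite lte_mul_pinfty// lee_fin.
  apply: ub_ereal_sup => _ [A [finA _]] <-.
  under eq_fsbigr do rewrite EFinM.
  rewrite -ge0_mule_fsumr; last by move=> j; rewrite lee_fin.
  apply: lee_wpmul2l; first by rewrite lee_fin.
  by apply: ereal_sup_ubound; exists A.
apply: (@le_lt_trans _ _ (\esum_(j in [set: J])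
    (((2 * normsq a) * normsq (xi j))%:E + (2 * normsq (eta j))%:E))%E).
  apply: le_esum => j _; rewrite -EFinD lee_fin.
  by rewrite -mulrA -normsqM; exact: normsqD_le.
rewrite esumD; last 2 first.
- by move=> j _; rewrite lee_fin !mulr_ge0// normsq_ge0.
- by move=> j _; rewrite lee_fin mulr_ge0// normsq_ge0.
apply: lte_add_pinfty; apply: scaled => //.
- by rewrite mulr_ge0// normsq_ge0.
- by move=> j; exact: normsq_ge0.
- by move=> j; exact: normsq_ge0.
Qed.

HB.instance Definition _ := GRing.isSubmodClosed.Build _ _ square_summable
  square_summable_submod.

(* The Hilbert space l^2(J). *)
Record l2 := L2 { l2val :> J -> R[i]; _ : l2val \in square_summable }.

HB.instance Definition _ := [isSub for l2val].
HB.instance Definition _ := [Choice of l2 by <:].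
HB.instance Definition _ := [SubChoice_isSubLmodule of l2 by <:].

Definition inner (xi eta : l2) : R[i] := csum (fun j => xi j * conjc (eta j)).

Definition l2norm (xi : l2) : R := Num.sqrt (fine (sqsum xi)).

Lemma delta_square_summable (j : J) :
  (fun i => (i == j)%:R) \in square_summable.
Proof.
apply/square_summableP.
suff -> : sqsum (fun i => (i == j)%:R) = 1%E by rewrite ltry.
rewrite -[RHS](@esum_set1 R J j (fun=> 1%E))// esum_mkcond/= /sqsum.
apply: eq_esum => i _; rewrite in_set1.
by case: eqVneq => _; rewrite /normsq/= !expr0n/= ?expr1n addr0.
Qed.

Definition delta (j : J) : l2 := L2 (delta_square_summable j).

Lemma l2P (xi eta : l2) : xi =1 eta -> xi = eta.
Proof. by move=> e; apply: val_inj; apply: funext. Qed.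

Lemma l2Z (a : R[i]) (xi : l2) j : (a *: xi) j = a * xi j.
Proof. by []. Qed.

Lemma inner_delta (i j : J) :
  inner (delta i) (delta j) = (i == j)%:R.
Proof.
rewrite /inner /csum /rsum/=.
have E (k : J) : ((k == i)%:R * conjc ((k == j)%:R) : R[i]) = ((k == i) && (i == j))%:R.
  by rewrite conjc_nat -natrM mulnb; case: eqVneq => [->|].
have Er (b : bool) : (b%:R : R[i]) = (b%:R : R) +i* 0 by case: b.
have S0 : \esum_(k in [set: J]) (0:R)%:E = 0%E by rewrite esum1.
have S1 : \esum_(k in [set: J]) (((k == i) && (i == j))%:R:R)%:E = ((i == j)%:R : R)%:E.
  rewrite -[RHS](@esum_set1 R J i (fun=> ((i == j)%:R:R)%:E)); last by rewrite lee_fin.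
  rewrite [RHS]esum_mkcond; apply: eq_esum => k _.
  by rewrite in_set1; case: eqVneq.
under eq_esum do rewrite E Er /= (max_idPl _)//.
under [X in (_ - X)%E]eq_esum do rewrite E Er /= (max_idPr _) ?oppr_le0//.
under [X in _ +i* fine (X - _)%E]eq_esum do rewrite E Er /= maxxx.
under [X in _ +i* fine (_ - X)%E]eq_esum do rewrite E Er /= oppr0 maxxx.
by rewrite S0 S1 /= !subr0 Er.
Qed.

End HilbertSpace.

Section Operators.
Variables (R : realType) (J : choiceType).
Local Notation H := (l2 R J).
Local Notation C := R[i].

(* Operators on H are kept as plain functions H -> H, so that they form a
   C-vector space pointwise; B(H) is the set [bounded_op]. *)
Definition opnorm (T : H -> H) : \bar R :=
  ereal_sup [set (l2norm (T xi))%:E | xi in [set xi : H | l2norm xi <= 1]].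

Definition bounded_op : set (H -> H) :=
  [set T | linear T /\ (opnorm T < +oo)%E].

(* M_n(B(H)) acts on the Hilbert space H^n. *)
Definition l2norm_n n (xi : 'I_n -> H) : R :=
  Num.sqrt (\sum_(i < n) l2norm (xi i) ^+ 2).

Definition mx_act n (X : 'M[H -> H]_n) (xi : 'I_n -> H) : 'I_n -> H :=
  fun i => \sum_(j < n) X i j (xi j).

Definition mx_opnorm n (X : 'M[H -> H]_n) : \bar R :=
  ereal_sup [set (l2norm_n (mx_act X xi))%:E
            | xi in [set xi : 'I_n -> H | l2norm_n xi <= 1]].

(* The elements of the predual of B(H), and the w*-topology they induce. *)
Definition predual : set ((H -> H) -> C^o) :=
  [set w | exists xi eta : nat -> H,
    [/\ (\esum_(k in [set: nat]) (l2norm (xi k) ^+ 2)%:E < +oo)%E,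
        (\esum_(k in [set: nat]) (l2norm (eta k) ^+ 2)%:E < +oo)%E &
        w = fun T => csum (fun k => inner (T (xi k)) (eta k))]].

Definition wstar : topologicalType :=
  initial_topology (fun (T : H -> H) =>
    (fun w : predual => val w T) : prod_topology (fun _ : predual => C^o)).

Definition wstar_closure (A : set (H -> H)) : set (H -> H) :=
  bounded_op `&` (closure (A : set wstar) : set (H -> H)).

Definition norm_closure (A : set (H -> H)) : set (H -> H) :=
  bounded_op `&` [set T | forall e : R, 0 < e ->
    exists2 x, A x & (opnorm (T - x)%R <= e%:E)%E].

Definition wstar_continuous_on (A : set (H -> H))
    (S : (H -> H) -> (H -> H)) : Prop :=
  {within (A : set wstar), continuous (S : wstar -> wstar)}.

(* For S : A -> B(H), with A a subspace of B(H): the norm of S, the norm of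
   id_{M_n} (x) S on M_n(A), and the completely bounded norm. *)
Definition map_norm (A : set (H -> H)) (S : (H -> H) -> (H -> H)) : \bar R :=
  ereal_sup [set opnorm (S x) | x in [set x | A x /\ (opnorm x <= 1)%E]].

Definition amplification_norm (A : set (H -> H)) (S : (H -> H) -> (H -> H))
    (n : nat) : \bar R :=
  ereal_sup [set mx_opnorm (map_mx S X)
            | X in [set X : 'M[H -> H]_n |
                     (forall i j, A (X i j)) /\ (mx_opnorm X <= 1)%E]].

Definition cb_norm (A : set (H -> H)) (S : (H -> H) -> (H -> H)) : \bar R :=
  ereal_sup [set amplification_norm A S n.+1 | n in [set: nat]].

End Operators.

Section QuantumTorus.
Variables (R : realType) (d : nat).
Local Notation Zd := 'rV[int]_d.
Local Notation H := (l2 R Zd).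

Lemma wshift_square_summable (t : Zd -> R) (m : Zd) (xi : H) :
  (fun n => expi (t n) * xi (n - m)) \in @square_summable R Zd.
Proof.
apply/square_summableP; case: xi => xi /= /square_summableP.
congr (_ < _)%E; rewrite /sqsum (@reindex_esum R _ _ setT _ (fun n : Zd => n - m)).
  by apply: eq_esum => n _; rewrite normsqM normsq_expi mul1r.
split => //.
  by move=> x y _ _ /addIr.
by move=> n _; exists (n + m) => //; rewrite addrK.
Qed.

Definition wshift (t : Zd -> R) (m : Zd) (xi : H) : H :=
  L2 (wshift_square_summable t m xi).

Lemma l2norm_wshift t m (xi : H) : l2norm (wshift t m xi) = l2norm xi.
Proof.
rewrite /l2norm; congr (Num.sqrt (fine _)).
rewrite /sqsum [RHS](@reindex_esum R _ _ setT _ (fun n : Zd => n - m)).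
  by apply: eq_esum => n _ /=; rewrite normsqM normsq_expi mul1r.
split => //.
  by move=> x y _ _ /addIr.
by move=> n _; exists (n + m) => //; rewrite addrK.
Qed.

Variable theta : 'M[R]_d.

Definition phase (k : 'I_d) (n : Zd) : R :=
  2 * pi * \sum_(j < d | (j < k)%N) theta k j * (n 0 j)%:~R.

Lemma phase_shift (k l : 'I_d) (n : Zd) (z : int) :
  phase k (n + z *: delta_mx 0 l) =
  phase k n + (if (l < k)%N then 2 * pi * (theta k l * z%:~R) else 0).
Proof.
rewrite /phase (eq_bigr (fun j => theta k j * (n 0 j)%:~R + 
   (if j == l then theta k l * z%:~R else 0))); last first.
  move=> j _; rewrite !mxE/= rmorphD mulrDr; congr (_ + _).
  by case: eqVneq => [->|]; rewrite ?mulr1// mulr0 mulr0.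
rewrite big_split/= mulrDr -big_mkcondr/=; congr (_ + _).
case: ifP => lk.
  rewrite (big_pred1 l)// => j/=; case: eqVneq => [->|]; by rewrite ?lk ?andbF.
rewrite big_pred0 ?mulr0// => j; case: eqVneq => [->|]; by rewrite ?lk ?andbF.
Qed.

(* The GNS space of tau is identified with l^2(Z^d), the class of U^n being
   [delta n]. Then U_k acts by left multiplication:
     U_k U^n = exp (2 pi i \sum_(j < k) theta_kj n_j) U^(n + e_k). *)
Definition generator (k : 'I_d) : H -> H := wshift (phase k) (delta_mx 0 k).

Definition generator_inv (k : 'I_d) : H -> H :=
  wshift (fun n => - phase k n) (- delta_mx 0 k).

Lemma generatorK k : cancel (generator k) (generator_inv k).
Proof.
move=> xi; apply: l2P => n /=.
rewrite mulrA opprK -[X in phase _ (_ + X)]scale1r phase_shift ltnn addr0.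
by rewrite -expiD addNr expi0 mul1r addrK.
Qed.

Lemma generator_invK k : cancel (generator_inv k) (generator k).
Proof.
move=> xi; apply: l2P => n /=.
rewrite mulrA opprK -[X in phase _ (_ + X)]scaleN1r phase_shift ltnn addr0.
by rewrite -expiD subrr expi0 mul1r subrK.
Qed.

Lemma generator_commute : theta^T = - theta -> forall k j xi,
  generator k (generator j xi) =
  expi (2 * pi * theta k j) *: generator j (generator k xi).
Proof.
move=> sk k j xi; apply: l2P => n; rewrite l2Z /=.
rewrite -[X in phase k (_ + X)]scaleN1r -[X in phase j (_ + X)]scaleN1r.
rewrite !phase_shift !mulrA -!expiD [n - _ - _]addrAC.
congr (expi _ * _); rewrite !mulrN1z.
have skE a b : theta a b = - theta b a.
  by move/matrixP: sk => /(_ b a); rewrite !mxE.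
case: ltngtP => [kj|jk|/val_inj ->].
- by rewrite (skE k j); ring.
- by ring.
- have -> : theta j j = 0 by have := skE j j; lra.
  by ring.
Qed.

Lemma generator_delta k n : generator k (delta R n) =
  expi (phase k n) *: delta R (n + delta_mx 0 k).
Proof.
apply: l2P => p; rewrite l2Z /= subr_eq.
case: eqVneq => [->|]; last by rewrite !mulr0.
by rewrite -[X in phase _ (_ + X)]scale1r phase_shift ltnn addr0.
Qed.

Definition generator_pow (k : 'I_d) (z : int) : H -> H :=
  match z with
  | Posz p => iter p (generator k)
  | Negz p => iter p.+1 (generator_inv k)
  end.

Lemma generator_pow_delta (k : 'I_d) (n : Zd) z :
  (forall j : 'I_d, (j < k)%N -> n 0 j = 0) ->
  generator_pow k z (delta R n) = delta R (n + z *: delta_mx 0 k).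
Proof.
move=> n0.
have step y : generator k (delta R (n + y *: delta_mx 0 k)) =
    delta R (n + (y + 1) *: delta_mx 0 k).
  rewrite generator_delta phase_shift ltnn addr0 /phase big1 ?mulr0.
    by rewrite expi0 scale1r scalerDl scale1r addrA.
  by move=> j /n0 ->; rewrite mulr0.
case: z => [p|p]; rewrite /generator_pow.
  elim: p => [|p IH]; first by rewrite scale0r addr0.
  by rewrite iterS IH step -PoszD addn1.
rewrite NegzE; elim: p.+1 => [|q IH]; first by rewrite /= oppr0 scale0r addr0.
rewrite iterS IH; apply: (can_inj (@generatorK k)).
by rewrite generator_invK step; congr (delta _ (_ + _ *: _)); rewrite -addn1 PoszD; ring.
Qed.

(* U^m = U_1^(m_1) ... U_d^(m_d) *)
Definition monomial (m : Zd) : H -> H :=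
  \big[comp/id]_(k < d) generator_pow k (m 0 k).

Lemma monomial_delta0 (m : Zd) : monomial m (delta R 0) = delta R m.
Proof.
have srt : sorted (relpre val ltn) (index_enum 'I_d).
  by rewrite -sorted_map -[index_enum _]enumT val_enum_ord iota_ltn_sorted.
have m_sum : m = \sum_(k < d) m 0 k *: delta_mx 0 k by exact: row_sum_delta.
rewrite [in RHS]m_sum /monomial; elim: (index_enum _) srt => [|k s IH] /= ps.
  by rewrite !big_nil.
rewrite !big_cons /= (IH (path_sorted ps)) generator_pow_delta 1?addrC// => j jk.
rewrite summxE big_seq big1// => l ls; rewrite !mxE/=.
have tr : transitive (relpre (@nat_of_ord d) ltn) by move=> a b c; apply: ltn_trans.
have /allP/(_ l ls) /= kl := order_path_min tr ps.
by case: eqVneq => [jl|]; rewrite ?mulr0//; move: (ltn_trans jk kl); rewrite jl ltnn.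
Qed.

Definition polynomials : set (H -> H) :=
  [set x | exists (s : seq Zd) (a : Zd -> R[i]),
    x = \sum_(m <- s) a m *: monomial m].

(* The image of the C*-algebra A_theta in the GNS representation of tau; as
   that representation is faithful, it is isometric and this is A_theta. *)
Definition Atheta : set (H -> H) := norm_closure polynomials.

(* For theta = 0 this is L_oo of the d-torus. *)
Definition Linf : set (H -> H) := wstar_closure Atheta.

(* tau is the vector state of the class of the unit; hence
   tau ((U^m)^* x) = <x delta_0, U^m delta_0>. *)
Definition fourier_coef (x : H -> H) (m : Zd) : R[i] :=
  inner (x (delta R 0)) (monomial m (delta R 0)).

(* S is a w*-continuous linear extension to L_oo of T_phi. *)
Definition extends_multiplier (phi : Zd -> R[i])
    (S : (H -> H) -> (H -> H)) : Prop :=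
  [/\ forall x, Linf x -> Linf (S x),
      forall (a : R[i]) x y, Linf x -> Linf y -> S (a *: x + y) = a *: S x + S y,
      wstar_continuous_on Linf S &
      forall x, polynomials x -> polynomials (S x) /\
        forall m, fourier_coef (S x) m = phi m * fourier_coef x m].

Definition multipliers : set (Zd -> R[i]) :=
  [set phi | exists S, extends_multiplier phi S /\ (map_norm Linf S < +oo)%E].

Definition cb_multipliers : set (Zd -> R[i]) :=
  [set phi | exists S, extends_multiplier phi S /\ (cb_norm Linf S < +oo)%E].

(* Such an extension is unique on L_oo, since polynomials are w*-dense. *)
Definition multiplier_map (phi : Zd -> R[i]) : (H -> H) -> (H -> H) :=
  xget (id : (H -> H) -> (H -> H)) [set S | extends_multiplier phi S].

Definition multiplier_norm (phi : Zd -> R[i]) : \bar R :=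
  map_norm Linf (multiplier_map phi).

Definition cb_multiplier_norm (phi : Zd -> R[i]) : \bar R :=
  cb_norm Linf (multiplier_map phi).

End QuantumTorus.

(* Main.v *)
(* In the basis [U^n] of [l^2(Z^d)] the matrix of [x] in [L_oo(T^d_theta)] has
   entries [x^(m - n)] up to phases that depend on [theta] only.  Hence [T_phi]
   is the restriction of the Schur multiplier with kernel [phi (m - n)], and
   [cb_norm T_phi] is at most the cb norm of that Schur multiplier.
   Conversely, for a finite matrix [a], conjugation by [diag (U^(r i))] turns
   [a] into the matrix [a_ij U^(r i) (U^(r j))^*] of polynomials, with no larger
   norm, and on it [T_phi] acts as the Schur multiplier.  So the cb norm is the
   same for all [theta].
   For [theta = 0] the norm of [T_phi] already controls the Schur multiplier:
   [\sum_ij a_ij v_j w_i^* U^(r i - r j)] has norm at most [|a| |v| |w|], its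
   image under [T_phi] has coefficient sum [<(phi * a) v, w>], and the sum of
   the coefficients of a polynomial is bounded by its norm since [Z^d] is
   amenable.
   A bounded Schur multiplier is w*-continuous on [B(H)], because its transpose
   maps functionals of finite rank to such functionals and the predual is norm
   closed; this gives the w*-continuous extensions. *)

Require Import Defs.
From mathcomp Require Import all_boot all_order all_algebra.
From mathcomp Require Import all_classical all_reals all_analysis.
From mathcomp Require Import finmap complex ring lra zify.
From mathcomp Require Import showcase.summability.

Set Implicit Arguments.
Unset Strict Implicit.
Unset Printing Implicit Defensive.

Import Order.TTheory GRing.Theory Num.Theory.
Import numFieldNormedType.Exports.

Local Open Scope classical_set_scope.
Local Open Scope ring_scope.
Local Open Scope complex_scope.

(* Two choices keep the argument elementary. The Schur condition speaks of scalar matrices over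
   arbitrary labels, so a matrix of operators, cut down to finitely many coordinates, is again one
   scalar matrix and complete boundedness costs nothing extra. And every estimate compares squared
   norms, which are limits of finite sums. The obstacle is w*-continuity. The elements of [predual]
   come with explicit sequences of vectors, so a norm limit of finite-rank functionals is not
   visibly one of them. Representing vectors are needed whose squared norms are controlled by the
   norm of the functional. For a finite matrix they come from its singular values, shared evenly
   between the two factors; a limit is then treated as a fast telescoping series. The map behind
   [multiplier_norm] is selected by choice among the extensions of [T_phi], so norms are compared
   for arbitrary extensions. What such a comparison uses of an extension is its matrix entries on
   [Linf], which w*-density of the polynomials determines. *)
#[local] Existing Instance totally_filter.

(** * Sums over arbitrary index sets *)

Section RealSums.
Variables (R : realType) (J : choiceType).
Implicit Types (f g : J -> R) (s t : R).

(** [rsum] subtracts two extended sums; convergence along the finite subsets makes linearity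
    immediate. The two notions are joined by [dominated_has_sum]. *)
Record has_sum f s : Prop := HasSum {
  has_sum_cvg : (fun A : {fset J} => \sum_(j <- A) f j) @ totally --> s }.

Lemma has_sum_unique f s t : has_sum f s -> has_sum f t -> s = t.
Proof. by move=> [fs] [ft]; apply: (cvg_unique _ fs ft). Qed.

Lemma eq_has_sum f g s : f =1 g -> has_sum f s -> has_sum g s.
Proof. by move=> /funext ->. Qed.

Lemma has_sumD f g s t :
  has_sum f s -> has_sum g t -> has_sum (fun j => f j + g j) (s + t).
Proof.
move=> [fs] [gt]; split; under eq_fun do rewrite big_split/=.
exact: cvgD.
Qed.

Lemma has_sumZ c f s : has_sum f s -> has_sum (fun j => c * f j) (c * s).
Proof.
move=> [fs]; split; under eq_fun do rewrite -mulr_sumr.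
by apply: cvgM => //; exact: cvg_cst.
Qed.

Lemma has_sumN f s : has_sum f s -> has_sum (fun j => - f j) (- s).
Proof.
move=> /(has_sumZ (-1)); rewrite mulN1r; apply: eq_has_sum => j.
by rewrite mulN1r.
Qed.

Lemma has_sumB f g s t :
  has_sum f s -> has_sum g t -> has_sum (fun j => f j - g j) (s - t).
Proof. by move=> fs /has_sumN gt; exact: has_sumD. Qed.

Lemma has_sum_fset (A : {fset J}) f :
  (forall j, j \notin A -> f j = 0) -> has_sum f (\sum_(j <- A) f j).
Proof.
move=> f0; split; apply: cvg_near_cst; exists A => // B /= AB.
by apply/esym/big_fset_incl => // j _; exact: f0.
Qed.

Lemma has_sum_sum (I : Type) (r : seq I) (F : I -> J -> R) (S : I -> R) :
  (forall i, has_sum (F i) (S i)) ->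
  has_sum (fun j => \sum_(i <- r) F i j) (\sum_(i <- r) S i).
Proof.
move=> FS; elim: r => [|i r IH].
  rewrite big_nil; apply: (@eq_has_sum (fun=> 0)) => [j|]; first by rewrite big_nil.
  by split; apply: cvg_near_cst; apply: nearW => A; rewrite big1.
rewrite big_cons; apply: (eq_has_sum _ (has_sumD (FS i) IH)) => j.
by rewrite big_cons.
Qed.

Lemma has_sum_le_ub f s c :
  has_sum f s -> (forall A : {fset J}, \sum_(j <- A) f j <= c) -> s <= c.
Proof. by move=> [fs] fc; apply: (cvgr_to_le fs); apply: nearW. Qed.

Lemma ler_sum_fset (A B : {fset J}) f : (forall j, 0 <= f j) ->
  (A `<=` B)%fset -> \sum_(j <- A) f j <= \sum_(j <- B) f j.
Proof.
move=> f0 AB; rewrite (big_fsetID _ (mem A) B)/= -[leLHS]addr0.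
apply: lerD; last by rewrite big_seq_cond sumr_ge0.
rewrite (_ : [fset x in B | x \in A]%fset = A)//; apply/fsetP => j.
by rewrite !inE/= andbC; case: (boolP (j \in A)) => //= /(fsubsetP AB) ->.
Qed.

Lemma has_sum_ge f s (A : {fset J}) : (forall j, 0 <= f j) ->
  has_sum f s -> \sum_(j <- A) f j <= s.
Proof.
move=> f0 [fs]; apply: (cvgr_to_ge fs); exists A => // B /= AB.
exact: ler_sum_fset.
Qed.

Lemma has_sum_ge0 f s : (forall j, 0 <= f j) -> has_sum f s -> 0 <= s.
Proof.
by move=> f0 /(has_sum_ge fset0 f0); rewrite big_seq_fset0.
Qed.

Lemma has_sum_le f g s t :
  has_sum f s -> has_sum g t -> (forall j, f j <= g j) -> s <= t.
Proof.
move=> fs gt fg; rewrite -subr_ge0; apply: has_sum_ge0 (has_sumB gt fs) => j.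
by rewrite subr_ge0.
Qed.

Lemma bounded_has_sum f c : (forall j, 0 <= f j) ->
  (forall A : {fset J}, \sum_(j <- A) f j <= c) -> exists s, has_sum f s.
Proof.
move=> f0 fc; pose E := [set \sum_(j <- A) f j | A in [set: {fset J}]].
have supE : has_sup E.
  by split; [exists (\sum_(j <- fset0) f j), fset0 | exists c => _ [A _ <-]].
exists (sup E); split; apply/cvgrPdist_le => e e0.
have [_ [A _ <-] EA] := sup_adherent e0 supE.
exists A => // B /= AB.
have EB : \sum_(j <- B) f j <= sup E by apply: ub_le_sup; [case: supE|exists B].
rewrite ger0_norm ?subr_ge0// lerBlDr -lerBlDl (le_trans (ltW EA))//.
exact: ler_sum_fset.
Qed.

Lemma has_sum_esum f s : (forall j, 0 <= f j) -> has_sum f s ->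
  \esum_(j in [set: J]) (f j)%:E = s%:E.
Proof.
move=> f0 fs; apply/eqP; rewrite eq_le; apply/andP; split.
  apply: ub_ereal_sup => _ [A [finA _]] <-.
  rewrite fsbig_finite//= sumEFin lee_fin; exact: has_sum_ge.
rewrite leNgt; apply/negP => lt_s.
have e0 : (0%:E <= \esum_(j in [set: J]) (f j)%:E)%E.
  by apply: esum_ge0 => j _; rewrite lee_fin.
move: lt_s e0; case E: (\esum_(j in _) _)%E => [r| |] //.
rewrite lte_fin => rs _; have : s <= r; last by rewrite leNgt rs.
apply: (has_sum_le_ub fs) => A; rewrite -lee_fin -E -sumEFin.
rewrite [leLHS](_ : _ = \sum_(j \in [set` A]) (f j)%:E)%E; last first.
  by rewrite fsbig_finite//= set_fsetK.
by apply: ereal_sup_ubound; exists [set` A].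
Qed.

Lemma esum_has_sum f : (forall j, 0 <= f j) ->
  (\esum_(j in [set: J]) (f j)%:E < +oo)%E ->
  has_sum f (fine (\esum_(j in [set: J]) (f j)%:E)).
Proof.
move=> f0 foo.
have e0 : (0%:E <= \esum_(j in [set: J]) (f j)%:E)%E.
  by apply: esum_ge0 => j _; rewrite lee_fin.
have [s fs] : exists s, has_sum f s; last by rewrite (has_sum_esum f0 fs).
apply: (@bounded_has_sum f (fine (\esum_(j in [set: J]) (f j)%:E))) => // A.
rewrite -lee_fin fineK; last by rewrite ge0_fin_numE.
rewrite -sumEFin [leLHS](_ : _ = \sum_(j \in [set` A]) (f j)%:E)%E; last first.
  by rewrite fsbig_finite//= set_fsetK.
by apply: ereal_sup_ubound; exists [set` A].
Qed.

(** Domination makes the sums of the positive and of the negative part both finite, so that [fine]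
    in [rsum] returns the genuine difference. *)
Lemma dominated_has_sum f g t : has_sum g t -> (forall j, `|f j| <= g j) ->
  has_sum f (rsum f).
Proof.
move=> gt fg.
have h k : (forall j, 0 <= k j) -> (forall j, k j <= g j) ->
    has_sum k (fine (\esum_(j in [set: J]) (k j)%:E)).
  move=> k0 kg; apply: esum_has_sum => //; apply: (@le_lt_trans _ _ t%:E);
    last exact: ltry.
  have g0 j : 0 <= g j by rewrite (le_trans (k0 j)).
  by rewrite -(has_sum_esum g0 gt); apply: le_esum => j _; rewrite lee_fin.
have hp : has_sum (fun j => Num.max (f j) 0)
    (fine (\esum_(j in [set: J]) (Num.max (f j) 0)%:E)).
  apply: h => j; first by rewrite le_max lexx orbT.
  by rewrite ge_max (le_trans (ler_norm _) (fg j)) (le_trans _ (fg j)).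
have hn : has_sum (fun j => Num.max (- f j) 0)
    (fine (\esum_(j in [set: J]) (Num.max (- f j) 0)%:E)).
  apply: h => j; first by rewrite le_max lexx orbT.
  by rewrite ge_max (le_trans (ler_norm _)) ?normrN// (le_trans _ (fg j)).
have := has_sumB hp hn.
rewrite /rsum [X in fine (X - _)%E](has_sum_esum _ hp); last first.
  by move=> j; rewrite le_max lexx orbT.
rewrite [X in fine (_ - X)%E](has_sum_esum _ hn) /=; last first.
  by move=> j; rewrite le_max lexx orbT.
apply: eq_has_sum => j; case: (leP 0 (f j)) => fj.
  by rewrite (max_idPr _) ?oppr_le0// subr0.
by rewrite (max_idPl _) ?oppr_ge0 ?ltW// sub0r opprK.
Qed.

End RealSums.

(** * Complex sums, through real and imaginary parts *)

Section ComplexSums.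
Variables (R : realType) (J : choiceType).
Local Notation C := R[i].
Implicit Types (f g : J -> C) (s t : C).

Definition has_csum f s : Prop :=
  has_sum (fun j => complex.Re (f j)) (complex.Re s) /\
  has_sum (fun j => complex.Im (f j)) (complex.Im s).

Lemma complex_eq s t :
  complex.Re s = complex.Re t -> complex.Im s = complex.Im t -> s = t.
Proof. by case: s t => [a b] [c e] /= -> ->. Qed.

Lemma ReM s t : complex.Re (s * t) =
  complex.Re s * complex.Re t - complex.Im s * complex.Im t.
Proof. by case: s t => [a b] [c e]. Qed.

Lemma ImM s t : complex.Im (s * t) =
  complex.Re s * complex.Im t + complex.Im s * complex.Re t.
Proof. by case: s t => [a b] [c e]. Qed.

Lemma ReD s t : complex.Re (s + t) = complex.Re s + complex.Re t.
Proof. by case: s t => [a b] [c e]. Qed.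

Lemma ImD s t : complex.Im (s + t) = complex.Im s + complex.Im t.
Proof. by case: s t => [a b] [c e]. Qed.

Lemma ReB s t : complex.Re (s - t) = complex.Re s - complex.Re t.
Proof. by case: s t => [a b] [c e]. Qed.

Lemma ImB s t : complex.Im (s - t) = complex.Im s - complex.Im t.
Proof. by case: s t => [a b] [c e]. Qed.

Lemma conjcM s t : conjc (s * t) = conjc s * conjc t.
Proof. exact: rmorphM. Qed.

Lemma Re_conjc s : complex.Re (conjc s) = complex.Re s.
Proof. by case: s. Qed.

Lemma Im_conjc s : complex.Im (conjc s) = - complex.Im s.
Proof. by case: s. Qed.

Lemma Re_sum (I : Type) (r : seq I) (F : I -> C) :
  complex.Re (\sum_(i <- r) F i) = \sum_(i <- r) complex.Re (F i).
Proof. by apply: (big_morph _ ReD). Qed.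

Lemma Im_sum (I : Type) (r : seq I) (F : I -> C) :
  complex.Im (\sum_(i <- r) F i) = \sum_(i <- r) complex.Im (F i).
Proof. by apply: (big_morph _ ImD). Qed.

Lemma has_csum_unique f s t : has_csum f s -> has_csum f t -> s = t.
Proof.
move=> [fs1 fs2] [ft1 ft2].
by apply: complex_eq; [exact: has_sum_unique fs1 ft1|exact: has_sum_unique fs2 ft2].
Qed.

Lemma eq_has_csum f g s : f =1 g -> has_csum f s -> has_csum g s.
Proof. by move=> /funext ->. Qed.

Lemma has_csumD f g s t :
  has_csum f s -> has_csum g t -> has_csum (fun j => f j + g j) (s + t).
Proof.
move=> [fs1 fs2] [gt1 gt2]; split.
  by rewrite ReD; apply: eq_has_sum (has_sumD fs1 gt1) => j; rewrite ReD.
by rewrite ImD; apply: eq_has_sum (has_sumD fs2 gt2) => j; rewrite ImD.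
Qed.

Lemma has_csumZ c f s : has_csum f s -> has_csum (fun j => c * f j) (c * s).
Proof.
move=> [fs1 fs2]; split.
  rewrite ReM; apply: eq_has_sum (has_sumB (has_sumZ _ fs1) (has_sumZ _ fs2)) => j.
  by rewrite ReM.
rewrite ImM; apply: eq_has_sum (has_sumD (has_sumZ _ fs2) (has_sumZ _ fs1)) => j.
by rewrite ImM.
Qed.

Lemma has_csum_conj f s :
  has_csum f s -> has_csum (fun j => conjc (f j)) (conjc s).
Proof.
move=> [fs1 fs2]; split.
  by rewrite Re_conjc; apply: eq_has_sum fs1 => j; rewrite Re_conjc.
by rewrite Im_conjc; apply: eq_has_sum (has_sumN fs2) => j; rewrite Im_conjc.
Qed.

Lemma has_csum_fset (A : {fset J}) f :
  (forall j, j \notin A -> f j = 0) -> has_csum f (\sum_(j <- A) f j).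
Proof.
move=> f0; split; rewrite ?Re_sum ?Im_sum; apply: has_sum_fset => j /f0 -> //.
Qed.

Lemma has_csum_sum (I : Type) (r : seq I) (F : I -> J -> C) (S : I -> C) :
  (forall i, has_csum (F i) (S i)) ->
  has_csum (fun j => \sum_(i <- r) F i j) (\sum_(i <- r) S i).
Proof.
move=> FS; split; rewrite ?Re_sum ?Im_sum.
  apply: (@eq_has_sum _ _ (fun j => \sum_(i <- r) complex.Re (F i j))).
    by move=> j; rewrite Re_sum.
  by apply: has_sum_sum => i; have [] := FS i.
apply: (@eq_has_sum _ _ (fun j => \sum_(i <- r) complex.Im (F i j))).
  by move=> j; rewrite Im_sum.
by apply: has_sum_sum => i; have [] := FS i.
Qed.

(** The left side is a continuous function of finitely many partial sums taken over the same [A].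
    This carries estimates for finite matrices over to infinitely many columns. *)
Lemma has_csum_bound (I : finType) (F : I -> J -> C) (S : I -> C) (c : R) :
  (forall i, has_csum (F i) (S i)) ->
  (forall A : {fset J}, \sum_i normsq (\sum_(j <- A) F i j) <= c) ->
  \sum_i normsq (S i) <= c.
Proof.
move=> FS Fc.
have h : (fun A : {fset J} => \sum_i normsq (\sum_(j <- A) F i j)) @ totally
    --> \sum_i normsq (S i).
  apply: cvg_big => [|i _]; first exact: add_continuous.
 have [[h1] [h2]] := FS i; rewrite /normsq.
  under eq_fun do rewrite Re_sum Im_sum !expr2.
  by rewrite !expr2; apply: cvgD; apply: cvgM.
by apply: (cvgr_to_le h); apply: nearW.
Qed.

Lemma has_csum_normsq f s c : has_csum f s ->
  (forall A : {fset J}, normsq (\sum_(j <- A) f j) <= c) -> normsq s <= c.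
Proof.
move=> fs fc; have := @has_csum_bound 'I_1 (fun=> f) (fun=> s) c (fun=> fs).
by rewrite big_ord1; apply => A; rewrite big_ord1.
Qed.

Lemma dominated_has_csum f (g : J -> R) (t : R) : has_sum g t ->
  (forall j, `|complex.Re (f j)| <= g j) ->
  (forall j, `|complex.Im (f j)| <= g j) -> has_csum f (csum f).
Proof.
by move=> gt fg1 fg2; split; [exact: dominated_has_sum gt _|
  exact: dominated_has_sum gt _].
Qed.

End ComplexSums.

(** * The Hilbert space l2 *)

Section FiniteSums.
Variable R : realType.
Implicit Types (z w : R[i]).

Lemma normsq_eq0 z : normsq z = 0 -> z = 0.
Proof.
case: z => a b /eqP; rewrite /normsq/= paddr_eq0 ?sqr_ge0// !sqrf_eq0.
by move=> /andP[/eqP -> /eqP ->].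
Qed.

Lemma normsq0 : normsq (0 : R[i]) = 0.
Proof. by rewrite /normsq/= expr0n addr0. Qed.

Lemma normsq_conj z : normsq (conjc z) = normsq z.
Proof. by case: z => a b; rewrite /normsq/= sqrrN. Qed.

Lemma normsqN z : normsq (- z) = normsq z.
Proof. by case: z => a b; rewrite /normsq/= !sqrrN. Qed.

Lemma mul_conjc z : z * conjc z = (normsq z)%:C.
Proof. by case: z => a b; rewrite /normsq; apply: complex_eq => /=; ring. Qed.

Lemma normsq_real (a : R) : normsq (a%:C) = a ^+ 2.
Proof. by rewrite /normsq/= expr0n addr0. Qed.

Lemma Re_sq_le z : complex.Re z ^+ 2 <= normsq z.
Proof. by rewrite /normsq lerDl sqr_ge0. Qed.

Lemma Im_sq_le z : complex.Im z ^+ 2 <= normsq z.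
Proof. by rewrite /normsq lerDr sqr_ge0. Qed.

Lemma normsq_sumM (I : Type) (r : seq I) (a b : I -> R[i]) :
  normsq (\sum_(i <- r) a i * b i) <=
  (\sum_(i <- r) normsq (a i)) * (\sum_(i <- r) normsq (b i)).
Proof.
elim: r => [|i r IH]; first by rewrite !big_nil normsq0 mul0r.
rewrite !big_cons; set S := \sum_(j <- r) _ in IH *.
set A := \sum_(j <- r) _ in IH *; set B := \sum_(j <- r) _ in IH *.
have A0 : 0 <= A by apply: sumr_ge0 => j _; exact: normsq_ge0.
have B0 : 0 <= B by apply: sumr_ge0 => j _; exact: normsq_ge0.
have a0 := normsq_ge0 (a i); have b0 := normsq_ge0 (b i).
(* The cross term: its square is controlled by the induction hypothesis on [S], and the
   arithmetic-geometric mean inequality separates [normsq (a i) * B] from [A * normsq (b i)]. *)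
have key : 2 * complex.Re (a i * b i * conjc S) <=
    normsq (a i) * B + A * normsq (b i).
  have h : complex.Re (a i * b i * conjc S) ^+ 2 <= normsq (a i) * normsq (b i) * (A * B).
    apply: le_trans (Re_sq_le _) _; rewrite normsqM normsq_conj normsqM.
    by apply: ler_wpM2l => //; exact: mulr_ge0.
  set x := complex.Re _ in h *.
  have {}h : (2 * x) ^+ 2 <= (normsq (a i) * B + A * normsq (b i)) ^+ 2.
    have := sqr_ge0 (normsq (a i) * B - A * normsq (b i)); nra.
  apply: le_trans (ler_norm _) _; rewrite -ler_sqr ?real_normK ?num_real//.
    by rewrite nnegrE addr_ge0 ?mulr_ge0.
rewrite [leLHS](_ : _ = normsq (a i * b i) + normsq S + 2 * complex.Re (a i * b i *
  conjc S)).
  by rewrite normsqM; nra.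
by case: (a i * b i) S {IH key} => [u v] [s t]; rewrite /normsq/=; ring.
Qed.

End FiniteSums.

Section L2.
Variables (R : realType) (J : choiceType).
Local Notation H := (l2 R J).
Local Notation C := R[i].
Implicit Types (xi eta : H).

Definition N2 xi : R := fine (sqsum xi).

Lemma l2norm_sq xi : l2norm xi ^+ 2 = N2 xi.
Proof.
rewrite /l2norm sqr_sqrtr// fine_ge0// esum_ge0// => j _.
by rewrite lee_fin normsq_ge0.
Qed.

Lemma N2_has_sum xi : has_sum (fun j => normsq (xi j)) (N2 xi).
Proof.
apply: esum_has_sum => [j|]; first exact: normsq_ge0.
by apply/square_summableP; case: xi.
Qed.

Lemma N2_ge0 xi : 0 <= N2 xi.
Proof. by rewrite -l2norm_sq sqr_ge0. Qed.

Lemma N2_unique xi s : has_sum (fun j => normsq (xi j)) s -> N2 xi = s.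
Proof. exact: has_sum_unique (N2_has_sum xi). Qed.

Lemma N2_ge xi (A : {fset J}) : \sum_(j <- A) normsq (xi j) <= N2 xi.
Proof. by apply: has_sum_ge (N2_has_sum xi) => j; exact: normsq_ge0. Qed.

Lemma N2_coord xi j : normsq (xi j) <= N2 xi.
Proof. by have := N2_ge xi [fset j]%fset; rewrite big_seq_fset1. Qed.

Lemma l2_sum (I : Type) (r : seq I) (F : I -> H) j :
  (\sum_(i <- r) F i) j = \sum_(i <- r) F i j.
Proof. by apply: (big_morph (fun xi : H => xi j)). Qed.

Lemma N2Z a xi : N2 (a *: xi) = normsq a * N2 xi.
Proof.
apply: N2_unique; apply: (eq_has_sum _ (has_sumZ (normsq a) (N2_has_sum xi))).
by move=> j; rewrite l2Z normsqM.
Qed.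

Lemma N2_0 : N2 (0 : H) = 0.
Proof. by rewrite -(scale0r (0 : H)) N2Z normsq0 mul0r. Qed.

Lemma N2D_le xi eta : N2 (xi + eta) <= 2 * N2 xi + 2 * N2 eta.
Proof.
apply: (has_sum_le (N2_has_sum _)
  (has_sumD (has_sumZ (2) (N2_has_sum xi)) (has_sumZ (2) (N2_has_sum eta)))).
by move=> j; exact: normsqD_le.
Qed.

Lemma l2_exists (f : J -> C) c :
  (forall A : {fset J}, \sum_(j <- A) normsq (f j) <= c) ->
  exists xi : H, xi =1 f.
Proof.
move=> fc; have [s fs] := bounded_has_sum (fun j => normsq_ge0 (f j)) fc.
have ff : f \in @square_summable R J.
  apply/square_summableP; rewrite /sqsum (has_sum_esum _ fs) ?ltry// => j.
  exact: normsq_ge0.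
by exists (L2 ff).
Qed.

Lemma ReIm_mul_le (z w : C) :
  `|complex.Re (z * conjc w)| <= normsq z + normsq w /\
  `|complex.Im (z * conjc w)| <= normsq z + normsq w.
Proof.
case: z w => [a b] [c e]; rewrite /normsq/= !ler_norml.
have := sqr_ge0 (a - c); have := sqr_ge0 (b - e).
have := sqr_ge0 (a + c); have := sqr_ge0 (b + e).
have := sqr_ge0 (a - e); have := sqr_ge0 (b - c).
have := sqr_ge0 (a + e); have := sqr_ge0 (b + c).
have := sqr_ge0 a; have := sqr_ge0 b; have := sqr_ge0 c; have := sqr_ge0 e.
rewrite !sqrrB !sqrrD => *; split; apply/andP; split; lra.
Qed.

Lemma inner_has_csum xi eta :
  has_csum (fun j => xi j * conjc (eta j)) (inner xi eta).
Proof.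
apply: dominated_has_csum (has_sumD (N2_has_sum xi) (N2_has_sum eta)) _ _ => j;
  by have [] := ReIm_mul_le (xi j) (eta j).
Qed.

Lemma inner_unique xi eta s :
  has_csum (fun j => xi j * conjc (eta j)) s -> inner xi eta = s.
Proof. exact: has_csum_unique (inner_has_csum xi eta). Qed.

Lemma inner_normsq_le xi eta : normsq (inner xi eta) <= N2 xi * N2 eta.
Proof.
apply: has_csum_normsq (inner_has_csum xi eta) _ => A.
apply: le_trans (normsq_sumM _ _ _) _.
apply: ler_pM; rewrite ?sumr_ge0 ?N2_ge//.
- by move=> j _; exact: normsq_ge0.
- by move=> j _; exact: normsq_ge0.
- by under eq_bigr do rewrite normsq_conj; exact: N2_ge.
Qed.

Lemma innerDl xi xi' eta : inner (xi + xi') eta = inner xi eta + inner xi' eta.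
Proof.
apply: inner_unique; apply: (eq_has_csum _
  (has_csumD (inner_has_csum xi eta) (inner_has_csum xi' eta))) => j.
by rewrite -mulrDl.
Qed.

Lemma innerZl a xi eta : inner (a *: xi) eta = a * inner xi eta.
Proof.
apply: inner_unique; apply: (eq_has_csum _ (has_csumZ (a) (inner_has_csum xi eta))).
by move=> j; rewrite l2Z mulrA.
Qed.

Lemma inner_conj xi eta : inner eta xi = conjc (inner xi eta).
Proof.
apply: inner_unique; apply: (eq_has_csum _ (has_csum_conj (inner_has_csum xi eta))) => j.
by rewrite rmorphM/= conjcK mulrC.
Qed.

Lemma innerBl xi xi' eta : inner (xi - xi') eta = inner xi eta - inner xi' eta.
Proof. by rewrite -scaleN1r innerDl innerZl mulN1r. Qed.

Lemma innerBr xi eta eta' : inner xi (eta - eta') = inner xi eta - inner xi eta'.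
Proof. by rewrite (inner_conj (eta - eta')) innerBl (inner_conj eta xi) (inner_conj
  eta' xi) rmorphB. Qed.

Lemma inner_deltar xi j : inner xi (delta R j) = xi j.
Proof.
apply: inner_unique.
have := @has_csum_fset R J [fset j]%fset (fun k => xi k * conjc (delta R j k)).
rewrite big_seq_fset1 /= eqxx conjc1 mulr1; apply => k.
by rewrite inE => /negbTE ->; rewrite conjc0 mulr0.
Qed.

Definition fcomb (A : {fset J}) (c : J -> C) : H := \sum_(j <- A) c j *: delta R j.

Lemma fcombE A c j : fcomb A c j = if j \in A then c j else 0.
Proof.
rewrite l2_sum; under eq_bigr do rewrite l2Z/=.
case: ifPn => jA.
  rewrite (big_fsetD1 j)//= eqxx mulr1 big_seq big1 ?addr0// => k.
  by rewrite !inE => /andP[/negbTE kj _]; rewrite eq_sym kj mulr0.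
rewrite big_seq big1// => k kA; case: eqVneq => [e|]; rewrite ?mulr0//.
by rewrite e kA in jA.
Qed.

Lemma N2_fcomb A c : N2 (fcomb A c) = \sum_(j <- A) normsq (c j).
Proof.
apply: N2_unique.
have := @has_sum_fset R J A (fun j => normsq (fcomb A c j)).
rewrite [X in has_sum _ X](_ : _ = \sum_(j <- A) normsq (c j)); last first.
  by apply: eq_big_seq => j jA; rewrite fcombE jA.
by apply => j jA; rewrite fcombE (negbTE jA) normsq0.
Qed.

Lemma N2_sub_fcomb A xi : N2 (xi - fcomb A xi) = N2 xi - \sum_(j <- A) normsq (xi j).
Proof.
apply: N2_unique; rewrite -(N2_fcomb A xi).
apply: (eq_has_sum _ (has_sumB (N2_has_sum xi) (N2_has_sum (fcomb A xi)))) => j.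
rewrite -[(xi - fcomb A xi) j]/(xi j - fcomb A xi j) fcombE.
by case: ifP => _; rewrite ?subrr ?normsq0 ?subr0.
Qed.

Lemma fcomb_approx xi (e : R) : 0 < e ->
  exists A : {fset J}, N2 (xi - fcomb A xi) <= e.
Proof.
move=> e0; have /has_sum_cvg/cvgrPdist_le/(_ e e0) [A _ /(_ A (fsubset_refl A))] :=
  N2_has_sum xi.
by move=> h; exists A; rewrite N2_sub_fcomb (le_trans (ler_norm _) h).
Qed.

Lemma N2_delta j : N2 (delta R j) = 1.
Proof.
have := N2_fcomb [fset j]%fset (fun=> 1); rewrite /fcomb !big_seq_fset1 scale1r.
by rewrite /normsq/= expr1n expr0n addr0.
Qed.

End L2.

(** * Operator norms as best constants in quadratic inequalities *)

Section HomogeneousSup.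
Variables (R : realType) (V : Type) (sc : R[i] -> V -> V) (F G : V -> R).
Hypotheses (F0 : forall v, 0 <= F v) (G0 : forall v, 0 <= G v)
  (FZ : forall a v, F (sc a v) = normsq a * F v)
  (GZ : forall a v, G (sc a v) = normsq a * G v).

(** Quadratic scaling is all that [opnorm] and [mx_opnorm] have in common here; both
    characterizations by an inequality for all vectors are instances. *)
Lemma homogeneous_sup_le (c : R) : 0 <= c ->
  (ereal_sup [set (Num.sqrt (F v))%:E | v in [set v | (Num.sqrt (G v) <= 1)%R]]
    <= c%:E)%E <-> forall v, F v <= c ^+ 2 * G v.
Proof.
move=> c0; split => [h v|h]; last first.
  apply: ge_ereal_sup => _ [v /= v1] <-; rewrite lee_fin.
  rewrite -(ler_sqr (sqrtr_ge0 _))// sqr_sqrtr//; apply: le_trans (h v) _.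
  rewrite -[leRHS]mulr1 ler_wpM2l ?sqr_ge0//.
  by rewrite -(sqr_sqrtr (G0 v)) expr_le1// sqrtr_ge0.
apply/ler_addgt0Pr => e e0.
(* Normalizing by [G v + d] instead of [G v] covers [G v = 0]; the loss [c ^+ 2 * d] stays below
   [e]. *)
pose d := e / (c ^+ 2 + 1).
have c1 : 0 < c ^+ 2 + 1 by rewrite ltr_wpDl// sqr_ge0.
have d0 : 0 < d by rewrite divr_gt0.
have s0 : 0 < G v + d by rewrite ltr_wpDl.
pose a : R[i] := ((Num.sqrt (G v + d))^-1)%:C.
have na : normsq a = (G v + d)^-1 by rewrite normsq_real exprVn sqr_sqrtr// ltW.
have: ((Num.sqrt (F (sc a v)))%:E <= c%:E)%E.
  apply: le_trans h; apply: ereal_sup_ubound; exists (sc a v) => //=;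
    rewrite -[leRHS]sqrtr1 ler_sqrt ?ler01// GZ na.
  by rewrite ler_pdivrMl// mulr1 lerDl ltW.
rewrite lee_fin -(ler_sqr (sqrtr_ge0 _))// sqr_sqrtr// FZ na ler_pdivrMl//.
move=> /le_trans; apply.
have : d * (c ^+ 2 + 1) = e by rewrite /d divfK// gt_eqF.
by move=> <-; move: d0; nra.
Qed.

End HomogeneousSup.

(** * Bounded operators and Schur multipliers *)

Section Operators.
Variables (R : realType) (J : choiceType).
Local Notation H := (l2 R J).
Local Notation C := R[i].
Implicit Types (xi eta : H) (T x y : H -> H).

Lemma linear_opD T (Tl : linear T) xi eta : T (xi + eta) = T xi + T eta.
Proof. by have := Tl 1 xi eta; rewrite !scale1r. Qed.

Lemma linear_op0 T (Tl : linear T) : T 0 = 0.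
Proof. by apply: (@addrI _ (T 0)); rewrite -(linear_opD Tl) !addr0. Qed.

Lemma linear_opZ T (Tl : linear T) a xi : T (a *: xi) = a *: T xi.
Proof. by have := Tl a xi 0; rewrite (linear_op0 Tl) !addr0. Qed.

Lemma linear_opB T (Tl : linear T) xi eta : T (xi - eta) = T xi - T eta.
Proof. by rewrite -scaleN1r (linear_opD Tl) (linear_opZ Tl) scaleN1r. Qed.

Lemma linear_op_sum T (Tl : linear T) (I : Type) (r : seq I) (F : I -> H) :
  T (\sum_(i <- r) F i) = \sum_(i <- r) T (F i).
Proof. by apply: (big_morph T) => [xi eta|]; [exact: linear_opD|exact: linear_op0]. Qed.

Lemma op_sumE (I : Type) (r : seq I) (F : I -> H -> H) xi :
  (\sum_(i <- r) F i) xi = \sum_(i <- r) F i xi.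
Proof. by apply: (big_morph (fun T : H -> H => T xi)). Qed.

(** The clause [0 <= c] is there because the squared inequality does not see the sign of [c]. *)
Definition op_bound T (c : R) : Prop :=
  [/\ linear T, 0 <= c & forall xi, N2 (T xi) <= c ^+ 2 * N2 xi].

Lemma opnorm_leP T c : linear T -> 0 <= c ->
  (opnorm T <= c%:E)%E <-> forall xi, N2 (T xi) <= c ^+ 2 * N2 xi.
Proof.
move=> Tl c0.
apply: (@homogeneous_sup_le R H *:%R (fun xi => N2 (T xi)) (@N2 R J)) => //.
- by move=> xi; exact: N2_ge0.
- exact: N2_ge0.
- by move=> a xi; rewrite (linear_opZ Tl) N2Z.
- exact: N2Z.
Qed.

Lemma opnorm_ge0 T : (0 <= opnorm T)%E.
Proof.
apply: (@le_trans _ _ (l2norm (T 0))%:E); first by rewrite lee_fin sqrtr_ge0.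
apply: ereal_sup_ubound; exists 0 => //=.
by rewrite /l2norm -/(N2 0) N2_0 sqrtr0 ler01.
Qed.

Lemma opnorm_op_bound T c : linear T -> (opnorm T <= c%:E)%E -> op_bound T c.
Proof.
move=> Tl Tc; have c0 : 0 <= c by rewrite -lee_fin (le_trans (opnorm_ge0 T)).
by split => //; apply/opnorm_leP.
Qed.

Lemma op_bound_opnorm T c : op_bound T c -> (opnorm T <= c%:E)%E.
Proof. by move=> [Tl c0 Tc]; apply/opnorm_leP. Qed.

Lemma op_bound_bounded T c : op_bound T c -> bounded_op T.
Proof.
move=> Tc; split; first by case: Tc.
by rewrite (le_lt_trans (op_bound_opnorm Tc))// ltry.
Qed.

Lemma bounded_op_bound T : bounded_op T -> exists2 c, 0 < c & op_bound T c.
Proof.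
move=> [Tl Too]; exists (fine (opnorm T) + 1).
  by rewrite ltr_wpDl// fine_ge0// opnorm_ge0.
apply: opnorm_op_bound => //; rewrite EFinD fineK ?ge0_fin_numE ?opnorm_ge0//.
by rewrite leeDl// lee_fin.
Qed.

Lemma bounded_op_linear T : bounded_op T -> linear T.
Proof. by case. Qed.

Lemma op_boundP T (c : R) : 0 <= c -> linear T ->
  (forall xi, N2 (T xi) <= c * N2 xi) -> op_bound T (Num.sqrt c).
Proof. by move=> c0 Tl Tc; split; rewrite ?sqrtr_ge0// => xi; rewrite sqr_sqrtr. Qed.

Lemma bounded_op_linear_comb a x y :
  bounded_op x -> bounded_op y -> bounded_op (a *: x + y).
Proof.
move=> /bounded_op_bound[c c0 [xl _ xc]] /bounded_op_bound[e e0 [yl _ ye]].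
apply: (@op_bound_bounded _ (Num.sqrt (2 * (normsq a * c ^+ 2) + 2 * e ^+ 2))).
apply: op_boundP.
- by rewrite addr_ge0// mulr_ge0// ?sqr_ge0// mulr_ge0 ?normsq_ge0 ?sqr_ge0.
- move=> b xi eta; rewrite -![(a *: x + y) _]/(a *: x _ + y _) xl yl.
  by rewrite !scalerDr !scalerA [a * b]mulrC addrACA.
- move=> xi; rewrite -[(a *: x + y) _]/(a *: x xi + y xi).
  apply: le_trans (N2D_le _ _) _; rewrite N2Z.
  have xc' := ler_wpM2l (normsq_ge0 a) (xc xi).
  by have := ye xi; lra.
Qed.

Lemma bounded_op0 : bounded_op (0 : H -> H).
Proof.
apply: (@op_bound_bounded _ 0); split => //.
  by move=> a xi eta; rewrite -![(0 : H -> H) _]/(0 : H) scaler0 addr0.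
by move=> xi; rewrite -[(0 : H -> H) _]/(0 : H) N2_0 expr0n mul0r.
Qed.

Lemma bounded_opB x y : bounded_op x -> bounded_op y -> bounded_op (x - y).
Proof.
by move=> xb yb; rewrite -[x - y]addrC -scaleN1r; exact: bounded_op_linear_comb.
Qed.

Lemma bounded_op_sum (I : Type) (r : seq I) (a : I -> C) (F : I -> H -> H) :
  (forall i, bounded_op (F i)) -> bounded_op (\sum_(i <- r) a i *: F i).
Proof.
move=> Fb; elim: r => [|i r IH]; first by rewrite big_nil; exact: bounded_op0.
by rewrite big_cons; exact: bounded_op_linear_comb.
Qed.

(** Boundedness moves [x] past the truncations [fcomb B xi], which tend to [xi] in norm. Hence a
    bounded operator is determined by its matrix, and identities between operators can be checked on
    entries. *)
Lemma op_coord x xi m : bounded_op x ->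
  has_csum (fun n => x (delta R n) m * xi n) (x xi m).
Proof.
move=> /bounded_op_bound[c c0 [xl _ xc]].
have fE (A : {fset J}) : \sum_(n <- A) x (delta R n) m * xi n = x (fcomb A xi) m.
  rewrite /fcomb (linear_op_sum xl) l2_sum; apply: eq_bigr => n _.
  by rewrite (linear_opZ xl) l2Z mulrC.
have bnd (e : R) : 0 < e -> \forall A \near totally,
    normsq (x xi m - \sum_(n <- (A : {fset J})) x (delta R n) m * xi n) <= e ^+ 2.
  move=> e0; have c2 : 0 < c ^+ 2 by rewrite exprn_gt0.
  have [A NA] := @fcomb_approx R J xi (e ^+ 2 / c ^+ 2) (divr_gt0 (exprn_gt0 2 e0) c2).
  exists A => // B /= AB; rewrite fE -[_ - _]/((x xi - x (fcomb B xi)) m).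
  rewrite -(linear_opB xl); apply: le_trans (N2_coord _ _) _.
  apply: le_trans (xc _) _; rewrite mulrC -ler_pdivlMr//; apply: le_trans NA.
  by rewrite !N2_sub_fcomb lerD2l lerN2; apply: ler_sum_fset => // n; exact: normsq_ge0.
split; split; apply/cvgrPdist_le => e e0; apply: filterS (bnd e e0) => A.
  move=> /(le_trans (Re_sq_le _)) h; rewrite -Re_sum -raddfB /=.
  by rewrite -(ler_sqr (normr_ge0 _)) ?real_normK ?num_real// nnegrE ltW.
move=> /(le_trans (Im_sq_le _)) h; rewrite -Im_sum -raddfB /=.
by rewrite -(ler_sqr (normr_ge0 _)) ?real_normK ?num_real// nnegrE ltW.
Qed.

Lemma bounded_op_ext x y : bounded_op x -> bounded_op y ->
  (forall m n, x (delta R n) m = y (delta R n) m) -> x = y.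
Proof.
move=> xb yb xy; apply/funext => xi; apply: l2P => m.
apply: has_csum_unique (op_coord _ _ xb) _.
by apply: (eq_has_csum _ (op_coord xi m yb)) => n; rewrite xy.
Qed.

Lemma mx_opnorm_leP p (X : 'M[H -> H]_p) c :
  (forall i j, linear (X i j)) -> 0 <= c ->
  (mx_opnorm X <= c%:E)%E <-> forall xi : 'I_p -> H,
    \sum_i N2 (mx_act X xi i) <= c ^+ 2 * \sum_i N2 (xi i).
Proof.
move=> Xl c0.
have -> : mx_opnorm X = ereal_sup [set (Num.sqrt (\sum_i N2 (mx_act X xi i)))%:E
    | xi in [set xi : 'I_p -> H | Num.sqrt (\sum_i N2 (xi i)) <= 1]].
  have E (xi : 'I_p -> H) : l2norm_n xi = Num.sqrt (\sum_i N2 (xi i)).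
    by congr Num.sqrt; apply: eq_bigr => i _; rewrite l2norm_sq.
  congr ereal_sup; apply/seteqP; split => _ [xi /= xi1] <-.
    by exists xi; rewrite ?E// -E.
  by exists xi; rewrite ?E// -E.
apply: (@homogeneous_sup_le R ('I_p -> H) (fun a (xi : 'I_p -> H) i => a *: xi i)
  (fun xi : 'I_p -> H => \sum_i N2 (mx_act X xi i))
  (fun xi : 'I_p -> H => \sum_i N2 (xi i))) => //.
- by move=> xi; apply: sumr_ge0 => i _; exact: N2_ge0.
- by move=> xi; apply: sumr_ge0 => i _; exact: N2_ge0.
- move=> a xi; rewrite mulr_sumr; apply: eq_bigr => i _.
  rewrite -N2Z /mx_act scaler_sumr; congr N2.
  by apply: eq_bigr => j _; rewrite (linear_opZ (Xl i j)).
- by move=> a xi; rewrite mulr_sumr; apply: eq_bigr => i _; rewrite N2Z.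
Qed.

End Operators.

(** * Schur multipliers, from finite matrices to bounded operators *)

Section Schur.
Variables (R : realType) (J : choiceType) (k : J -> J -> R[i]).
Local Notation H := (l2 R J).
Local Notation C := R[i].
Implicit Types (xi eta : H) (x y : H -> H).

Definition contraction (I : finType) (a : I -> I -> C) : Prop :=
  forall v : I -> C, \sum_i normsq (\sum_j a i j * v j) <= \sum_j normsq (v j).

(* The labelling [r] need not be injective: repeated labels account for the
   matrix amplifications of the Schur multiplier. *)
Definition schur_bound (c : R) : Prop :=
  forall (I : finType) (r : I -> J) (a : I -> I -> C), contraction a ->
  forall v : I -> C, \sum_i normsq (\sum_j k (r i) (r j) * a i j * v j) <=
    c ^+ 2 * \sum_j normsq (v j).

Variable c : R.
Hypotheses (c0 : 0 <= c) (kc : schur_bound c).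

(** The entries of all [X i j] on a finite block form a single scalar matrix indexed by pairs of a
    block index and a coordinate, to which [schur_bound] applies. *)
Lemma schur_finite (I : finType) (X : I -> I -> H -> H) (b : R) :
  (forall i j, linear (X i j)) -> 0 < b ->
  (forall xi : I -> H, \sum_i N2 (\sum_j X i j (xi j)) <= b ^+ 2 * \sum_i N2 (xi i)) ->
  forall (A B : {fset J}) (v : I -> J -> C),
  \sum_i \sum_(m <- A) normsq (\sum_(n <- B) \sum_j k m n * X i j (delta R n) m * v j n)
    <= (c * b) ^+ 2 * \sum_j \sum_(n <- B) normsq (v j n).
Proof.
(* [schur_bound] deals with square matrices, so rows and columns are enlarged to a common set and
   the vector is extended by zero. *)
move=> Xl b0 Xb A B v; pose D := (A `|` B)%fset.
pose w j n := if n \in B then v j n else 0.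
have wE (F : J -> C -> C) j : (forall n, F n 0 = 0) ->
    \sum_(n <- B) F n (v j n) = \sum_(n <- D) F n (w j n).
  move=> F0; have BD : (B `<=` D)%fset by exact: fsubsetUr.
  rewrite -[RHS](big_fset_incl _ BD) => [|n _ /negbTE nB]; last by rewrite /w nB.
  by apply: eq_big_seq => n nB; rewrite /w nB.
have wN j : \sum_(n <- B) normsq (v j n) = \sum_(n <- D) normsq (w j n).
  have BD : (B `<=` D)%fset by exact: fsubsetUr.
  rewrite -[RHS](big_fset_incl _ BD) => [|n _ /negbTE nB]; last by rewrite /w nB normsq0.
  by apply: eq_big_seq => n nB; rewrite /w nB.
under [in leRHS]eq_bigr do rewrite wN.
apply: (@le_trans _ _ (\sum_i \sum_(m <- D)
    normsq (\sum_(n <- D) \sum_j k m n * X i j (delta R n) m * w j n))).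
  apply: ler_sum => i _; rewrite (eq_bigr (fun m =>
      normsq (\sum_(n <- D) \sum_j k m n * X i j (delta R n) m * w j n))).
    by apply: ler_sum_fset => [m|]; [exact: normsq_ge0|exact: fsubsetUl].
  move=> m _; congr normsq; rewrite exchange_big [RHS]exchange_big/=.
  apply: eq_bigr => j _.
  by rewrite (wE (fun n z => k m n * X i j (delta R n) m * z))// => n; rewrite mulr0.
(* The label forgets the block index: every coordinate occurs once for each element of [I]. Division
   by [b] turns the matrix into a contraction. *)
pose r (p : I * D) := val p.2.
pose a (p q : I * D) := b%:C^-1 * X p.1 q.1 (delta R (val q.2)) (val p.2).
have bC : b%:C != 0 :> C by rewrite eq_complex /= eqxx andbT gt_eqF.
have ac : contraction a.
  move=> u; pose eta j : H := \sum_(n : D) u (j, n) *: delta R (val n).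
  have eN j : N2 (eta j) = \sum_(n : D) normsq (u (j, n)).
    pose u' n := if insub n is Some n' then u (j, n') else 0.
    have -> : eta j = fcomb D u'.
      by rewrite /fcomb big_seq_fsetE /=; apply: eq_bigr => n _; rewrite /u' valK.
    by rewrite N2_fcomb big_seq_fsetE /=; apply: eq_bigr => n _; rewrite /u' valK.
  have aE p : \sum_q a p q * u q = b%:C^-1 * (\sum_j X p.1 j (eta j)) (val p.2).
    rewrite l2_sum mulr_sumr.
    rewrite (eq_bigr (fun q => a p (q.1, q.2) * u (q.1, q.2))); last by case.
    rewrite -(pair_bigA _ (fun j n => a p (j, n) * u (j, n)))/=.
    apply: eq_bigr => j _; rewrite /eta (linear_op_sum (Xl _ j)) l2_sum mulr_sumr.
    by apply: eq_bigr => n _; rewrite (linear_opZ (Xl _ j)) l2Z /a/= -!mulrA;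
      congr (_ * _); rewrite mulrC.
  under eq_bigr do rewrite aE normsqM.
  rewrite -mulr_sumr (_ : normsq _ = (b ^+ 2)^-1); last first.
    have := normsqM (b%:C^-1 : C) b%:C.
    rewrite mulVf// normsq_real (_ : normsq 1 = 1);
      last by rewrite /normsq/= expr1n expr0n addr0.
    move=> e; have b2 : b ^+ 2 != 0 by rewrite gt_eqF// exprn_gt0.
    by apply: (mulIf b2); rewrite -e mulVf.
  rewrite ler_pdivrMl ?exprn_gt0//.
  apply: (@le_trans _ _ (b ^+ 2 * \sum_j N2 (eta j))).
    apply: le_trans (Xb eta).
    rewrite (eq_bigr (fun p : I * D => normsq ((\sum_j X (p.1, p.2).1 j (eta j)) (val
      (p.1, p.2).2)))); last by case.
    rewrite -(pair_bigA _ (fun i (m : D) => normsq ((\sum_j X i j (eta j)) (val m))))/=.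
    apply: ler_sum => i _; rewrite -(big_seq_fsetE _ _ predT (fun m => normsq ((\sum_j
      X i j (eta j)) m))).
    exact: N2_ge.
  rewrite ler_wpM2l ?sqr_ge0//; under eq_bigr do rewrite eN.
  by rewrite pair_bigA/= [leRHS](eq_bigr (fun p => normsq (u (p.1, p.2)))) => // -[].
have := kc r ac (fun q => b%:C * w q.1 (val q.2)).
set L := leLHS => h; apply: (@le_trans _ _ L).
  rewrite le_eqVlt; apply/orP; left; apply/eqP; rewrite /L.
  rewrite (eq_bigr (fun i => \sum_(m : D) normsq (\sum_(n <- D) \sum_j k (val m) n * X
    i j (delta R n) (val m) * w j n))); last first.
    by move=> i _; rewrite big_seq_fsetE.
  rewrite pair_bigA/=; apply: eq_bigr => -[i m] _ /=; congr normsq.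
  rewrite exchange_big/= (eq_bigr (fun j => \sum_(n : D) k (val m) (val n) * X i j
    (delta R (val n)) (val m) * w j (val n))); last first.
    by move=> j _; rewrite big_seq_fsetE.
  rewrite pair_bigA/=; apply: eq_bigr => -[j n] _ /=; rewrite /a/r/=.
  by field.
apply: le_trans h _; rewrite exprMn -(mulrA (c ^+ 2)) ler_wpM2l ?sqr_ge0//.
under [leLHS]eq_bigr do rewrite normsqM normsq_real.
rewrite -mulr_sumr ler_wpM2l ?sqr_ge0//.
rewrite le_eqVlt; apply/orP; left; apply/eqP.
rewrite [RHS](eq_bigr (fun j => \sum_(n : D) normsq (w j (val n)))) ?pair_bigA//.
by move=> j _; rewrite big_seq_fsetE.
Qed.

(** Finitely many rows are fixed first, then the columns are exhausted by [has_csum_bound], and the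
    rows last. As [eta] is described only by its coordinates, this serves both [schur] and operators
    known merely by their entries. *)
Lemma schur_limit (I : finType) (X : I -> I -> H -> H) (b : R) (xi eta : I -> H) :
  (forall i j, linear (X i j)) -> 0 < b ->
  (forall xi : I -> H, \sum_i N2 (\sum_j X i j (xi j)) <= b ^+ 2 * \sum_i N2 (xi i)) ->
  (forall i m, has_csum (fun n => \sum_j k m n * X i j (delta R n) m * xi j n)
    (eta i m)) ->
  \sum_i N2 (eta i) <= (c * b) ^+ 2 * \sum_i N2 (xi i).
Proof.
move=> Xl b0 Xb eta_xi.
apply: (has_sum_le_ub (has_sum_sum _ (fun i => N2_has_sum (eta i)))) => A.
rewrite exchange_big/= (eq_bigr (fun i => \sum_(m : A) normsq (eta i (val m))));
  last first.
  by move=> i _; rewrite big_seq_fsetE.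
rewrite pair_bigA/=.
apply: (@has_csum_bound R J _ (fun p : I * A => fun n =>
  \sum_j k (val p.2) n * X p.1 j (delta R n) (val p.2) * xi j n)) => [p|B].
  exact: eta_xi.
rewrite -(pair_bigA _ (fun i (m : A) => normsq (\sum_(n <- B) \sum_j k (val m) n * X i
  j (delta R n) (val m) * xi j n)))/=.
rewrite (eq_bigr (fun i => \sum_(m <- A) normsq (\sum_(n <- B) \sum_j k m n * X i j
  (delta R n) m * xi j n))); last first.
  by move=> i _; rewrite big_seq_fsetE.
apply: le_trans (schur_finite Xl b0 Xb A B (fun j => xi j)) _.
rewrite ler_wpM2l ?sqr_ge0//; apply: ler_sum => j _; exact: N2_ge.
Qed.

Lemma schur_entries_bound (I : finType) (X Y : I -> I -> H -> H) (b : R) :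
  (forall i j, bounded_op (X i j)) -> (forall i j, bounded_op (Y i j)) ->
  (forall i j m n, Y i j (delta R n) m = k m n * X i j (delta R n) m) -> 0 < b ->
  (forall xi : I -> H, \sum_i N2 (\sum_j X i j (xi j)) <= b ^+ 2 * \sum_i N2 (xi i)) ->
  forall xi : I -> H, \sum_i N2 (\sum_j Y i j (xi j)) <= (c * b) ^+ 2 * \sum_i N2 (xi i).
Proof.
move=> Xbo Ybo XY b0 Xb xi; apply: (@schur_limit _ X b) => // [i j|i m].
  exact: bounded_op_linear.
rewrite l2_sum.
apply: (eq_has_csum _ (has_csum_sum _ (fun j => op_coord (xi j) m (Ybo i j)))) => n.
by apply: eq_bigr => j _; rewrite XY.
Qed.

(** A vector with these coordinates need not exist for an arbitrary function [x], hence the choice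
    with default 0; [schurP] shows that the default does not matter for bounded [x]. *)
Definition schur x : H -> H := fun xi => xget 0 [set eta : H |
  forall m, has_csum (fun n => k m n * x (delta R n) m * xi n) (eta m)].

Lemma op_bound1 x b : op_bound x b -> forall xi : 'I_1 -> H,
  \sum_(i < 1) N2 (\sum_(j < 1) x (xi j)) <= b ^+ 2 * \sum_(i < 1) N2 (xi i).
Proof. by move=> [_ _ xb] xi; rewrite !big_ord1. Qed.

Lemma schur_finite1 x b (A B : {fset J}) (v : J -> C) : 0 < b -> op_bound x b ->
  \sum_(m <- A) normsq (\sum_(n <- B) k m n * x (delta R n) m * v n) <=
  (c * b) ^+ 2 * \sum_(n <- B) normsq (v n).
Proof.
move=> b0 xb; have xl : forall i j : 'I_1, linear x by case: xb.
have := @schur_finite 'I_1 (fun _ _ => x) b xl b0 (op_bound1 xb) A B (fun=> v).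
rewrite !big_ord1; apply: le_trans; rewrite le_eqVlt; apply/orP; left; apply/eqP.
by apply: eq_bigr => m _; congr normsq; apply: eq_bigr => n _; rewrite big_ord1.
Qed.

(** Testing the one-row block against its own conjugate gives [S ^+ 2 <= (c * b) ^+ 2 * S] for the
    sum [S] on the left, and [S] cancels unless it is 0. *)
Lemma schur_row_bound x b m (B : {fset J}) : 0 < b -> op_bound x b ->
  \sum_(n <- B) normsq (k m n * x (delta R n) m) <= (c * b) ^+ 2.
Proof.
move=> b0 xb; pose v n := conjc (k m n * x (delta R n) m).
have := schur_finite1 [fset m]%fset B v b0 xb; rewrite big_seq_fset1.
under eq_bigr do rewrite mul_conjc.
under [in leRHS]eq_bigr do rewrite normsq_conj.
set S := \sum_(n <- B) normsq _.
have -> : (\sum_(n <- B) (normsq (k m n * x (delta R n) m))%:C : C) = S%:C.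
  by rewrite /S rmorph_sum.
rewrite normsq_real => h.
have S0 : 0 <= S by apply: sumr_ge0 => n _; exact: normsq_ge0.
move: S0; rewrite le_eqVlt => /orP[/eqP <-|S0]; first exact: sqr_ge0.
by rewrite -(ler_pM2r S0) -expr2.
Qed.

(** Square summable rows make each coordinate an inner product with [xi], hence convergent; the
    block estimate then makes these coordinates square summable, hence a vector. *)
Lemma schurP x xi m : bounded_op x ->
  has_csum (fun n => k m n * x (delta R n) m * xi n) (schur x xi m).
Proof.
move=> /bounded_op_bound[b b0 xb].
suff [eta eta_xi] : exists eta : H,
    forall m, has_csum (fun n => k m n * x (delta R n) m * xi n) (eta m).
  by rewrite /schur; case: xgetP => [? _|/(_ eta)]; [apply|].
have row m' : exists rho : H, rho =1 (fun n => conjc (k m' n * x (delta R n) m')).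
  apply: (@l2_exists _ _ _ ((c * b) ^+ 2)) => B.
  by under eq_bigr do rewrite normsq_conj; exact: schur_row_bound.
have /choice[f ff] : forall m', exists s,
    has_csum (fun n => k m' n * x (delta R n) m' * xi n) s.
  move=> m'; have [rho rhoE] := row m'; exists (inner xi rho).
  apply: (eq_has_csum _ (inner_has_csum xi rho)) => n.
  by rewrite rhoE conjcK mulrC.
have [eta etaE] : exists eta : H, eta =1 f.
  apply: (@l2_exists _ _ _ ((c * b) ^+ 2 * N2 xi)) => A.
  rewrite big_seq_fsetE /=.
  apply: (@has_csum_bound R J _ (fun p : A => fun n =>
    k (val p) n * x (delta R n) (val p) * xi n)) => [p|B]; first exact: ff.
  rewrite -(big_seq_fsetE _ _ predT (fun m => normsq (\sum_(n <- B) k m n * x (delta R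
    n) m * xi n))) /=.
  apply: le_trans (schur_finite1 A B xi b0 xb) _.
  by rewrite ler_wpM2l ?sqr_ge0//; exact: N2_ge.
by exists eta => m'; rewrite etaE.
Qed.

Lemma schur_delta x m n : bounded_op x ->
  schur x (delta R n) m = k m n * x (delta R n) m.
Proof.
move=> xb; apply: has_csum_unique (schurP _ _ xb) _.
have := @has_csum_fset R J [fset n]%fset (fun p => k m p * x (delta R p) m * delta R n p).
rewrite big_seq_fset1 /= eqxx mulr1; apply => p.
by rewrite inE => /negbTE ->; rewrite mulr0.
Qed.

Lemma schur_op_bound x b : 0 < b -> op_bound x b -> op_bound (schur x) (c * b).
Proof.
move=> b0 xb; have xbo := op_bound_bounded xb.
split; last first.
- move=> xi; have xl : forall i j : 'I_1, linear x by case: xb.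
  have := @schur_limit 'I_1 (fun _ _ => x) b (fun=> xi) (fun=> schur x xi) xl b0
    (op_bound1 xb).
  rewrite !big_ord1; apply => _ m.
  by apply: (eq_has_csum _ (schurP xi m xbo)) => n; rewrite big_ord1.
- by rewrite mulr_ge0// ltW.
move=> a xi eta; apply: l2P => m.
apply: has_csum_unique (schurP _ _ xbo) _.
apply: (eq_has_csum _ (has_csumD (has_csumZ a (schurP xi m xbo)) (schurP eta m xbo)))
  => n.
by rewrite -[(a *: xi + eta) n]/(a * xi n + eta n); ring.
Qed.

Lemma schur_bounded x : bounded_op x -> bounded_op (schur x).
Proof.
by move=> /bounded_op_bound[b b0 /(schur_op_bound b0)]; exact: op_bound_bounded.
Qed.

Lemma schur_linear_comb a x y : bounded_op x -> bounded_op y ->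
  schur (a *: x + y) = a *: schur x + schur y.
Proof.
move=> xb yb; have xyb := bounded_op_linear_comb a xb yb.
apply: bounded_op_ext => [||m n]; first exact: schur_bounded.
  by apply: bounded_op_linear_comb; exact: schur_bounded.
rewrite schur_delta// -[in RHS](_ : a * schur x (delta R n) m + schur y (delta R n) m =
  (a *: schur x + schur y) (delta R n) m)// !schur_delta//.
by rewrite -[(a *: x + y) (delta R n) m]/(a * x (delta R n) m + y (delta R n) m); ring.
Qed.

End Schur.

(** * The predual of B(H) *)

Section TraceNorm.
Variable R : realType.
Local Notation C := R[i].

(** Pythagoras for orthogonal columns of squared lengths [e i]. It is used with [e = 1] for a
    unitary and with the squared singular values. *)
Lemma gram_diag (N : nat) (W : 'I_N -> 'I_N -> C) (e : 'I_N -> R) :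
  (forall i j, \sum_m conjc (W m i) * W m j = if i == j then (e i)%:C else 0) ->
  forall z : 'I_N -> C,
  \sum_m normsq (\sum_i W m i * z i) = \sum_i e i * normsq (z i).
Proof.
move=> We z; apply: complexI.
rewrite rmorph_sum/= [RHS]rmorph_sum/=.
transitivity (\sum_i \sum_j conjc (z i) * z j * \sum_m conjc (W m i) * W m j).
  under eq_bigr do rewrite -mul_conjc mulrC rmorph_sum mulr_suml.
  rewrite exchange_big/=; apply: eq_bigr => i _.
  under eq_bigr do rewrite mulr_sumr.
  rewrite exchange_big/=; apply: eq_bigr => j _.
  by rewrite mulr_sumr; apply: eq_bigr => m _; rewrite rmorphM/=; ring.
apply: eq_bigr => i _; under eq_bigr do rewrite We.
rewrite (bigD1 i)//= big1 ?addr0 => [|j ji].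
  by rewrite eqxx [conjc _ * _]mulrC mul_conjc mulrC -rmorphM.
by rewrite eq_sym (negbTE ji) mulr0.
Qed.

(* Singular values: [t = B U] with [U] unitary and the columns of [B]
   orthogonal, of lengths [s i]; the partial isometry [a] in the proof pairs
   with [t] to [\sum_i s i]. *)
Lemma trace_norm_decomposition (N : nat) (t : 'I_N -> 'I_N -> C) (b : R) :
  (forall a : 'I_N -> 'I_N -> C, contraction a ->
    complex.Re (\sum_m \sum_n t m n * a m n) <= b) ->
  exists P Q : 'I_N -> 'I_N -> C,
    [/\ forall m n, t m n = \sum_i P i n * conjc (Q i m),
        \sum_i \sum_n normsq (P i n) <= b &
        \sum_i \sum_m normsq (Q i m) <= b].
Proof.
move=> tb; pose A : 'M[C]_N := \matrix_(m, n) t m n.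
pose adj (X : 'M[C]_N) : 'M[C]_N := map_mx conjc X^T.
have adjM X Y : adj (X *m Y) = adj Y *m adj X.
  by rewrite /adj trmx_mul map_mxM.
have adjK X : adj (adj X) = X.
  by apply/matrixP => i j; rewrite !mxE conjcK.
(* The spectral theorem for this normal matrix yields the unitary [U]; then [adj B *m B] is diagonal
   for [B = A *m adj U], which is the orthogonality of the columns of [B]. *)
have Mn : adj A *m A \is @normalmx _ N.
  by apply/normalmxP; rewrite -/(adj _) adjM adjK.
have /orthomx_spectralP := Mn.
set U := spectralmx _; set sp := spectral_diag _ => AE.
have Uu : U \is unitarymx by exact: spectral_unitarymx.
have UU : U *m adj U = 1%:M by apply/unitarymxP.
have UU' : adj U *m U = 1%:M by apply: mulmx1C.
rewrite invmx_unitary// -/(adj U) in AE.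
pose B := A *m adj U.
have BU : B *m U = A by rewrite /B -mulmxA UU' mulmx1.
have BB : adj B *m B = diag_mx sp.
  rewrite /B adjM adjK mulmxA -(mulmxA U) AE.
  by rewrite !mulmxA UU mul1mx -mulmxA UU mulmx1.
pose d i := \sum_m normsq (B m i).
have d0 i : 0 <= d i by apply: sumr_ge0 => m _; exact: normsq_ge0.
have Bd i j : \sum_m conjc (B m i) * B m j = if i == j then (d i)%:C else 0.
  have /matrixP/(_ i j) := BB; rewrite !mxE.
  rewrite (eq_bigr (fun m => conjc (B m i) * B m j)) => [->|m _]; last by rewrite !mxE.
  case: eqVneq => [_|//]; have /matrixP/(_ i i) := BB; rewrite !mxE eqxx => <-.
  by rewrite /d rmorph_sum/=; apply: eq_bigr => m _; rewrite !mxE -mul_conjc mulrC.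
(* A column of length zero vanishes, so the convention that 0 has inverse 0 does no harm in the
   factorization. *)
have B0 i m : d i = 0 -> B m i = 0.
  move=> /eqP; rewrite /d psumr_eq0 => [/allP/(_ m (mem_index_enum m))/eqP|? _];
    last exact: normsq_ge0.
  exact: normsq_eq0.
pose s i := Num.sqrt (d i); pose q i := Num.sqrt (s i).
have s0 i : 0 <= s i by exact: sqrtr_ge0.
have q0 i : 0 <= q i by exact: sqrtr_ge0.
have sd i : s i ^+ 2 = d i by rewrite sqr_sqrtr.
have qs i : q i ^+ 2 = s i by rewrite sqr_sqrtr.
have Ur i j : \sum_n U i n * conjc (U j n) = (i == j)%:R.
  have /matrixP/(_ i j) := UU; rewrite !mxE => <-.
  by apply: eq_bigr => n _; rewrite !mxE.
have Uc i j : \sum_n conjc (U n i) * U n j = (i == j)%:R.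
  have /matrixP/(_ i j) := UU'; rewrite !mxE => <-.
  by apply: eq_bigr => n _; rewrite !mxE.
have sb : \sum_i s i <= b.
  (* The entrywise conjugate of the polar part of [t]: paired with [t] it leaves the diagonal terms
     [d i / s i = s i]. *)
  pose a m n := \sum_i conjc (B m i) * ((s i)^-1)%:C * conjc (U i n).
  have -> : \sum_i s i = complex.Re (\sum_m \sum_n t m n * a m n).
    have tE m n : t m n = \sum_j B m j * U j n.
      by have /matrixP/(_ m n) := BU; rewrite !mxE => <-.
    transitivity (complex.Re (\sum_i \sum_j ((s i)^-1)%:C *
        (\sum_m conjc (B m i) * B m j) * (\sum_n U j n * conjc (U i n)))).
      have -> : \sum_i s i = complex.Re (\sum_i (s i)%:C) by rewrite Re_sum.
      congr complex.Re; apply: eq_bigr => i _.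
      under eq_bigr do rewrite Bd Ur.
      rewrite (bigD1 i)//= big1 => [|j ji]; last by rewrite (negbTE ji) mulr0.
      rewrite !eqxx mulr1 addr0 -rmorphM -sd; congr (_%:C).
      by have [->|si] := eqVneq (s i) 0; rewrite ?invr0 ?mul0r// expr2 mulKf.
    congr complex.Re; under [RHS]eq_bigr do under eq_bigr do
      rewrite tE /a mulr_suml.
    rewrite [RHS](eq_bigr (fun m => \sum_i \sum_j \sum_n
        B m j * U j n * (conjc (B m i) * ((s i)^-1)%:C * conjc (U i n)))); last first.
      move=> m _; rewrite exchange_big [RHS]exchange_big/=; apply: eq_bigr => j _.
      rewrite exchange_big/=; apply: eq_bigr => n _.
      by rewrite mulr_sumr; apply: eq_bigr.
    rewrite [RHS]exchange_big/=; apply: eq_bigr => i _.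
    rewrite [RHS]exchange_big/=; apply: eq_bigr => j _.
    rewrite -mulrA mulr_suml mulr_sumr; apply: eq_bigr => m _.
    rewrite mulrA mulr_sumr.
    by apply: eq_bigr => n _; ring.
  apply: tb => v; pose y i := \sum_n conjc (U i n) * v n.
  have -> : \sum_i normsq (\sum_j a i j * v j) =
      \sum_m normsq (\sum_i conjc (B m i) * (((s i)^-1)%:C * y i)).
    apply: eq_bigr => m _; congr normsq; rewrite /a.
    under eq_bigr do rewrite mulr_suml.
    rewrite exchange_big/=; apply: eq_bigr => i _.
    by rewrite /y !mulr_sumr; apply: eq_bigr => n _; ring.
  rewrite (gram_diag (e := d)); last first.
    move=> i j; under eq_bigr do rewrite conjcK mulrC.
    by rewrite Bd eq_sym; case: eqVneq => // ->.
  have -> : \sum_j normsq (v j) = \sum_i normsq (y i).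
    rewrite (gram_diag (e := fun=> 1)) => [|i j].
      by apply: eq_bigr => i _; rewrite mul1r.
    under eq_bigr do rewrite conjcK mulrC.
    by rewrite Uc eq_sym; case: eqVneq.
  apply: ler_sum => i _; rewrite normsqM normsq_real mulrA -[leRHS]mul1r.
  rewrite ler_wpM2r ?normsq_ge0// -sd exprVn.
  by have [->|si] := eqVneq (s i) 0; rewrite ?expr0n ?mul0r ?ler01// mulfV// sqrf_eq0.
(* Since [q i ^+ 2 = s i], each singular value is shared evenly: both vectors with index [i] have
   squared length [s i]. *)
exists (fun i n => (q i)%:C * U i n), (fun i m => conjc (B m i) * ((q i)^-1)%:C).
split.
- move=> m n; have /matrixP/(_ m n) := BU; rewrite !mxE => <-.
  apply: eq_bigr => i _; rewrite conjcM conjcK conjc_real.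
  have [qi|qi] := eqVneq (q i) 0.
    rewrite B0 ?mul0r ?mulr0//.
    by rewrite -sd -qs qi !expr0n.
  transitivity ((q i * (q i)^-1)%:C * B m i * U i n); first by rewrite mulfV// mul1r.
  by rewrite rmorphM/=; ring.
- apply: le_trans sb; apply: ler_sum => i _.
  under eq_bigr do rewrite normsqM normsq_real qs.
  rewrite -mulr_sumr (_ : \sum_n _ = 1) ?mulr1//.
  apply: complexI; rewrite rmorph_sum/=; transitivity (\sum_n U i n * conjc (U i n));
    last by rewrite Ur eqxx.
  by apply: eq_bigr => n _; rewrite mul_conjc.
- apply: le_trans sb; apply: ler_sum => i _.
  under eq_bigr do rewrite normsqM normsq_conj normsq_real.
  rewrite -mulr_suml -/(d i) exprVn qs -sd.
  by have [->|si] := eqVneq (s i) 0; rewrite ?invr0 ?mulr0// expr2 mulfK.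
Qed.

End TraceNorm.

(** * Functionals given by finite matrices *)

Section FiniteFunctionals.
Variables (R : realType) (J : choiceType).
Local Notation H := (l2 R J).
Local Notation C := R[i].
Implicit Types (D : {fset J}) (t : J -> J -> C) (x y : H -> H).

Definition matrix_functional D t x : C :=
  \sum_(m <- D) \sum_(n <- D) t m n * x (delta R n) m.

Definition pair_functional (L : seq (H * H)) x : C :=
  \sum_(p <- L) inner (x p.1) p.2.

(** A crude bound: Cauchy-Schwarz, with every entry of an operator of norm at most 1 counted as 1.
    Only finiteness matters. *)
Lemma matrix_functional_bound D t : exists2 b, 0 <= b &
  forall x, op_bound x 1 -> normsq (matrix_functional D t x) <= b ^+ 2.
Proof.
pose r := [seq (m, n) | m <- D, n <- D].
pose c := \sum_(p <- r) normsq (t p.1 p.2); pose e : R := \sum_(p <- r) 1.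
have c0 : 0 <= c by apply: sumr_ge0 => ? _; exact: normsq_ge0.
have e0 : 0 <= e by apply: sumr_ge0 => ? _; exact: ler01.
exists (Num.sqrt (c * e)); first exact: sqrtr_ge0.
move=> x [xl _ xb]; rewrite sqr_sqrtr ?mulr_ge0//.
have -> : matrix_functional D t x = \sum_(p <- r) t p.1 p.2 * x (delta R p.2) p.1.
  by rewrite big_allpairs.
apply: le_trans (normsq_sumM _ _ _) _; rewrite ler_wpM2l//.
apply: ler_sum => -[m n] _ /=; apply: le_trans (N2_coord _ _) _.
by apply: le_trans (xb _) _; rewrite N2_delta expr1n mulr1.
Qed.

Lemma matrix_functional_widen D D' t x : (D `<=` D')%fset ->
  matrix_functional D t x = matrix_functional D'
    (fun m n => if (m \in D) && (n \in D) then t m n else 0) x.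
Proof.
move=> DD'; rewrite /matrix_functional.
rewrite -[RHS](big_fset_incl _ DD') => [|m _ /negbTE mD]; last first.
  by rewrite big1// => n _; rewrite mD/= mul0r.
apply: eq_big_seq => m mD; rewrite mD /=.
rewrite -[RHS](big_fset_incl _ DD') => [|n _ /negbTE nD]; last by rewrite nD/= mul0r.
by apply: eq_big_seq => n ->.
Qed.

Lemma matrix_functionalB D t D' t' : exists E s, forall x,
  matrix_functional D t x - matrix_functional D' t' x = matrix_functional E s x.
Proof.
exists (D `|` D')%fset, (fun m n =>
  (if (m \in D) && (n \in D) then t m n else 0) -
  (if (m \in D') && (n \in D') then t' m n else 0)) => x.
rewrite (matrix_functional_widen t x (fsubsetUl D D')).
rewrite (matrix_functional_widen t' x (fsubsetUr D D')).
rewrite /matrix_functional -sumrB; apply: eq_bigr => m _.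
by rewrite -sumrB; apply: eq_bigr => n _; rewrite -mulrBl.
Qed.

(** The norm of the functional is the trace norm of [t], so [trace_norm_decomposition], carried to
    the span of [delta] over [D], gives vectors controlled by the same [b]. *)
Lemma matrix_functional_pairs D t b : 0 <= b ->
  (forall x, op_bound x 1 -> normsq (matrix_functional D t x) <= b ^+ 2) ->
  exists L : seq (H * H),
    [/\ forall x, linear x -> matrix_functional D t x = pair_functional L x,
        \sum_(p <- L) N2 p.1 <= b & \sum_(p <- L) N2 p.2 <= b].
Proof.
move=> b0 tb; pose N := #|{: D}|; pose e (i : 'I_N) : J := val (enum_val i : D).
have De (V : nmodType) (F : J -> V) : \sum_(m <- D) F m = \sum_(i < N) F (e i).
  rewrite big_seq_fsetE /= [LHS](eq_bigl [in {: D}])//.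
  by rewrite (big_enum_val (fun m : D => F (val m))).
have e_inj : injective e by move=> i j /val_inj/enum_val_inj.
pose emb (v : 'I_N -> C) : H := \sum_i v i *: delta R (e i).
have embE v i : emb v (e i) = v i.
  rewrite l2_sum; under eq_bigr do rewrite l2Z/= (inj_eq e_inj).
  rewrite (bigD1 i)//= eqxx mulr1 big1 ?addr0// => j ji.
  by rewrite eq_sym (negbTE ji) mulr0.
have emb_inner xi v : inner xi (emb v) = \sum_i conjc (v i) * xi (e i).
  rewrite inner_conj.
  have -> : inner (emb v) xi = \sum_i v i * inner (delta R (e i)) xi.
    rewrite /emb; apply: (big_rec2 (fun (f : H) z => inner f xi = z)).
      by rewrite -(scale0r 0) innerZl mul0r.
    by move=> i z f _ <-; rewrite innerDl innerZl.
  rewrite raddf_sum /=; apply: eq_bigr => i _.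
  by rewrite conjcM (inner_conj xi) inner_deltar conjcK.
have embN v : N2 (emb v) = \sum_i normsq (v i).
  apply: complexI; rewrite -[LHS](_ : inner (emb v) (emb v) = _).
    rewrite emb_inner rmorph_sum; apply: eq_bigr => i _.
    by rewrite embE mulrC mul_conjc.
  apply: inner_unique; split.
    apply: (eq_has_sum _ (N2_has_sum (emb v))) => j.
    by rewrite mul_conjc.
  have -> : complex.Im (N2 (emb v))%:C = 0 by [].
  apply: (@eq_has_sum _ _ (fun=> 0)) => [j|]; first by rewrite mul_conjc.
  by have := has_sumZ 0 (N2_has_sum (emb v)); rewrite mul0r; apply: eq_has_sum => j;
    rewrite mul0r.
have matE x : matrix_functional D t x = \sum_m \sum_n t (e m) (e n) * x (delta R (e n))
  (e m).
  by rewrite /matrix_functional De; apply: eq_bigr => m _; rewrite De.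
have [|P [Q [tPQ Pb Qb]]] := @trace_norm_decomposition R N (fun m n => t (e m) (e n)) b.
  (* The scalar contraction, extended by zero to an operator on [H], tests the functional. *)
  move=> a ac; pose x (xi : H) : H := emb (fun m => \sum_n a m n * xi (e n)).
  have xE n m : x (delta R (e n)) (e m) = a m n.
    rewrite embE (bigD1 n)//= eqxx mulr1 big1 ?addr0// => j jn.
    by rewrite (inj_eq e_inj) (negbTE jn) mulr0.
  have xb : op_bound x 1.
    split => //.
      move=> c xi eta; rewrite /x /emb scaler_sumr -big_split/=.
      apply: eq_bigr => m _; rewrite scalerA -scalerDl; congr (_ *: _).
      rewrite mulr_sumr -big_split/=; apply: eq_bigr => n _.
      by transitivity (a m n * (c * xi (e n) + eta (e n))); [|ring].
    move=> xi; rewrite embN expr1n mul1r; apply: le_trans (ac _) _.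
    by rewrite -(De _ (fun n => normsq (xi n))); exact: N2_ge.
  have := tb x xb; rewrite matE.
  under eq_bigr do under eq_bigr do rewrite xE.
  move=> /(le_trans (Re_sq_le _)) h; apply: le_trans (ler_norm _) _.
  by rewrite -(ler_sqr (normr_ge0 _)) ?real_normK ?num_real// nnegrE.
exists [seq (emb (P i), emb (Q i)) | i <- index_enum 'I_N]; split.
- move=> x xl; rewrite matE /pair_functional big_map.
  rewrite (eq_bigr (fun m => \sum_i \sum_n P i n * conjc (Q i m) * x (delta R (e n)) (e
    m))); last first.
    move=> m _; rewrite exchange_big; apply: eq_bigr => n _.
    by rewrite tPQ mulr_suml.
  rewrite exchange_big/=; apply: eq_bigr => i _; rewrite emb_inner.
  apply: eq_bigr => m _; rewrite (linear_op_sum xl) l2_sum mulr_sumr.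
  by apply: eq_bigr => n _; rewrite (linear_opZ xl) l2Z; ring.
- by rewrite big_map; under eq_bigr do rewrite embN.
- by rewrite big_map; under eq_bigr do rewrite embN.
Qed.

End FiniteFunctionals.

(** * Approximating predual functionals by finite matrices *)

Section Predual.
Variables (R : realType) (J : choiceType).
Local Notation H := (l2 R J).
Local Notation C := R[i].
Implicit Types (x y : H -> H).

Lemma normsq_ReIm_le (z : C) r : 0 <= r -> normsq z <= r ^+ 2 ->
  `|complex.Re z| <= r /\ `|complex.Im z| <= r.
Proof.
move=> r0 zr; split.
  rewrite -(ler_sqr (normr_ge0 _)) ?nnegrE// real_normK ?num_real//.
  exact: le_trans (Re_sq_le _) zr.
rewrite -(ler_sqr (normr_ge0 _)) ?nnegrE// real_normK ?num_real//.
exact: le_trans (Im_sq_le _) zr.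
Qed.

Lemma normsqD_sq_le (z w : C) p q : 0 <= p -> 0 <= q ->
  normsq z <= p ^+ 2 -> normsq w <= q ^+ 2 -> normsq (z + w) <= (p + q) ^+ 2.
Proof.
move=> p0 q0 zp wq.
have -> : normsq (z + w) = normsq z + normsq w + 2 * complex.Re (z * conjc w).
  by case: z w {zp wq} => [a b] [c e]; rewrite /normsq/=; ring.
have [h _] : `|complex.Re (z * conjc w)| <= p * q /\ `|complex.Im (z * conjc w)| <= p * q.
  apply: normsq_ReIm_le; first exact: mulr_ge0.
  by rewrite normsqM normsq_conj exprMn; apply: ler_pM; rewrite ?normsq_ge0.
by have := ler_norm (complex.Re (z * conjc w)); nra.
Qed.

Lemma normsq_sum_sq_le (I : Type) (r : seq I) (f : I -> C) (h : I -> R) :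
  (forall i, 0 <= h i) -> (forall i, normsq (f i) <= h i ^+ 2) ->
  normsq (\sum_(i <- r) f i) <= (\sum_(i <- r) h i) ^+ 2.
Proof.
move=> h0 fh; elim: r => [|i r IH]; first by rewrite !big_nil normsq0 expr0n.
by rewrite !big_cons; apply: normsqD_sq_le => //; exact: sumr_ge0.
Qed.

(** Cauchy-Schwarz linearized by a weight: the bound sums over sequences of vectors, and a large [s]
    favours pairs whose first vector is small. *)
Lemma inner_op_le y c (s : R) (xi eta : H) : 0 < s -> op_bound y c ->
  normsq (inner (y xi) eta) <= (c * (s * N2 xi + s^-1 * N2 eta)) ^+ 2.
Proof.
move=> s0 [yl c0 yc]; apply: le_trans (inner_normsq_le _ _) _.
apply: (@le_trans _ _ (c ^+ 2 * (N2 xi * N2 eta))).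
  by rewrite mulrA ler_wpM2r ?N2_ge0.
rewrite exprMn ler_wpM2l ?sqr_ge0//.
have -> : N2 xi * N2 eta = (s * N2 xi) * (s^-1 * N2 eta).
  by rewrite mulrACA mulfV ?gt_eqF// mul1r.
have : 0 <= s * N2 xi by rewrite mulr_ge0 ?N2_ge0 ?ltW.
have : 0 <= s^-1 * N2 eta by rewrite mulr_ge0 ?N2_ge0// invr_ge0 ltW.
nra.
Qed.

Variant square_summable_pairs (xi eta : nat -> H) : Prop :=
  SquareSummablePairs (S T : R) of has_sum (fun k => N2 (xi k)) S &
    has_sum (fun k => N2 (eta k)) T.

Lemma pairs_has_csum y (xi eta : nat -> H) :
  square_summable_pairs xi eta -> bounded_op y ->
  has_csum (fun k => inner (y (xi k)) (eta k))
    (csum (fun k => inner (y (xi k)) (eta k))).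
Proof.
move=> [S T xiS etaT] /bounded_op_bound[c c0 yc].
have gS := has_sumZ c (has_sumD xiS etaT).
have bnd k := @inner_op_le y c 1 (xi k) (eta k) ltr01 yc.
have h k : 0 <= c * (N2 (xi k) + N2 (eta k)) by rewrite mulr_ge0 ?addr_ge0 ?N2_ge0 ?ltW.
apply: dominated_has_csum gS _ _ => k.
  by have := bnd k; rewrite invr1 !mul1r => /(normsq_ReIm_le (h k))[].
by have := bnd k; rewrite invr1 !mul1r => /(normsq_ReIm_le (h k))[].
Qed.

Lemma predualP (w : (H -> H) -> C^o) : predual w <->
  exists xi eta, square_summable_pairs xi eta /\
    w = fun T => csum (fun k => inner (T (xi k)) (eta k)).
Proof.
have esumP (z : nat -> H) :
    (\esum_(k in [set: nat]) (l2norm (z k) ^+ 2)%:E < +oo)%E <->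
    exists S, has_sum (fun k => N2 (z k)) S.
  split.
    under eq_esum do rewrite l2norm_sq; move=> h.
    by eexists; apply: esum_has_sum h => k; exact: N2_ge0.
  move=> [S zS]; under eq_esum do rewrite l2norm_sq.
  by rewrite (has_sum_esum _ zS) ?ltry// => k; exact: N2_ge0.
split=> [[xi [eta [/esumP[S xiS] /esumP[T etaT] ->]]]|[xi [eta [[S T xiS etaT] ->]]]].
  by exists xi, eta; split=> //; exists S T.
by exists xi, eta; split=> //; apply/esumP; [exists S|exists T].
Qed.

Definition truncate (A : {fset nat}) (D : {fset J}) (xi : nat -> H) (k : nat) : H :=
  if k \in A then fcomb D (xi k) else 0.

(** The estimate holds for all large [A] and then for all large [D], so that two sequences can be
    truncated with the same [A] and [D]. *)
Lemma truncate_approx (xi : nat -> H) S (e : R) : 0 < e ->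
  has_sum (fun k => N2 (xi k)) S ->
  exists A0, forall A, (A0 `<=` A)%fset -> exists D0, forall D, (D0 `<=` D)%fset ->
    exists2 s, has_sum (fun k => N2 (xi k - truncate A D xi k)) s & s <= e.
Proof.
move=> e0 xiS; have e2 : 0 < e / 2 by rewrite divr_gt0.
have [/cvgrPdist_le/(_ _ e2)[A0 _ HA0]] := xiS.
exists A0 => A /HA0 /= HA.
(* Half of [e] pays for the terms outside [A]; the other half is shared among the truncated vectors,
   the added 1 avoiding a division by 0. *)
pose d := e / 2 / (#|` A|%:R + 1).
have n0 : 0 < #|` A|%:R + 1 :> R by rewrite ltr_wpDl.
have d0 : 0 < d by rewrite divr_gt0.
have /choice[E HE] : forall k, exists D, N2 (xi k - fcomb D (xi k)) <= d.
  by move=> k; exact: fcomb_approx.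
exists (\bigcup_(k <- A) E k)%fset => D AD.
have HD k : k \in A -> N2 (xi k - fcomb D (xi k)) <= d.
  move=> kA; apply: le_trans (HE k); rewrite !N2_sub_fcomb lerD2l lerN2.
  apply: ler_sum_fset => [m|]; first exact: normsq_ge0.
  by apply: fsubset_trans AD; exact: bigfcup_sup.
pose g k := if k \in A then N2 (xi k - fcomb D (xi k)) - N2 (xi k) else 0.
have gA : has_sum g (\sum_(k <- A) g k).
  by apply: has_sum_fset => k /negbTE kA; rewrite /g kA.
exists (S + \sum_(k <- A) g k).
  apply: (eq_has_sum _ (has_sumD xiS gA)) => k; rewrite /truncate /g.
  by case: ifP => _; rewrite ?subr0 ?addr0// addrC subrK.
rewrite (eq_big_seq (fun k => N2 (xi k - fcomb D (xi k)) - N2 (xi k))) => [|k kA];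
  last by rewrite /g kA.
rewrite sumrB addrCA [leRHS](splitr e).
apply: lerD; last exact: le_trans (ler_norm _) HA.
apply: (@le_trans _ _ (\sum_(k <- A) d)).
  by rewrite big_seq [leRHS]big_seq; apply: ler_sum => k; exact: HD.
rewrite big_const_seq count_predT iter_addr addr0.
have -> : e / 2 = d * (#|` A|%:R + 1) by rewrite /d divfK// gt_eqF.
by rewrite mulrDr mulr1 mulr_natr lerDl ltW.
Qed.

Definition matrix_approximable (u : (H -> H) -> C) : Prop :=
  forall e : R, 0 < e -> exists D t, forall y c, 0 < c -> op_bound y c ->
    normsq (u y - matrix_functional D t y) <= (e * c) ^+ 2.

Lemma predual_approximable (w : (H -> H) -> C^o) :
  predual w -> matrix_approximable w.
Proof.
move=> /predualP[xi [eta [[S T xiS etaT] ->]]] e e0.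
have S0 : 0 <= S by apply: has_sum_ge0 xiS => k; exact: N2_ge0.
have T0 : 0 <= T by apply: has_sum_ge0 etaT => k; exact: N2_ge0.
(* Replacing one vector at a time leaves two products, each with a small factor of weight [s] and a
   large one of weight [s^-1]. This [s] brings the large factors to at most [e / 2] in total, and
   [d = e / 4 / s] brings each small one to [e / 4]. *)
pose s := (S + T + 1) / (e / 2); have e2 : 0 < e / 2 by rewrite divr_gt0.
have s0 : 0 < s by rewrite divr_gt0// ltr_wpDl// addr_ge0.
pose d := e / 4 / s; have d0 : 0 < d by rewrite divr_gt0// divr_gt0.
have [A1 HA1] := truncate_approx d0 xiS; have [A2 HA2] := truncate_approx d0 etaT.
pose A := (A1 `|` A2)%fset.
have [D1 HD1] := HA1 A (fsubsetUl _ _); have [D2 HD2] := HA2 A (fsubsetUr _ _).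
pose D := (D1 `|` D2)%fset.
have [s1 xs1 s1d] := HD1 D (fsubsetUl _ _); have [s2 es2 s2d] := HD2 D (fsubsetUr _ _).
pose t m n := \sum_(k <- A) xi k n * conjc (eta k m).
exists D, t => y c c0 yc; have [yl _ _] := yc.
pose xi' := truncate A D xi; pose eta' := truncate A D eta.
have fE k (f : H) : inner f (fcomb D (eta k)) = \sum_(m <- D) conjc (eta k m) * f m.
  apply: inner_unique.
  have -> : \sum_(m <- D) conjc (eta k m) * f m =
      \sum_(m <- D) f m * conjc (fcomb D (eta k) m).
    by apply: eq_big_seq => m mD; rewrite fcombE mD mulrC.
  by apply: has_csum_fset => m mD; rewrite fcombE (negbTE mD) conjc0 mulr0.
have h1 : has_csum (fun k => inner (y (xi' k)) (eta' k)) (matrix_functional D t y).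
  have -> : matrix_functional D t y = \sum_(k <- A) inner (y (xi' k)) (eta' k).
    transitivity (\sum_(k <- A) \sum_(m <- D) \sum_(n <- D)
        xi k n * conjc (eta k m) * y (delta R n) m).
      rewrite exchange_big; apply: eq_bigr => m _; rewrite exchange_big.
      by apply: eq_bigr => n _; rewrite mulr_suml.
    apply: eq_big_seq => k kA; rewrite /xi' /eta' /truncate kA fE.
    apply: eq_bigr => m _; rewrite /fcomb (linear_op_sum yl) l2_sum mulr_sumr.
    by apply: eq_bigr => n _; rewrite (linear_opZ yl) l2Z; ring.
  apply: has_csum_fset => k kA; rewrite /xi' /truncate (negbTE kA) (linear_op0 yl).
  by rewrite -(scale0r 0) innerZl mul0r.
have h2 := pairs_has_csum (SquareSummablePairs xiS etaT) (op_bound_bounded yc).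
have h3 := has_csumD h2 (has_csumZ (-1) h1).
rewrite -mulN1r.
pose h k := c * (s * N2 (xi k - xi' k) + s^-1 * N2 (eta k)) +
  c * (s^-1 * N2 (xi k) + s * N2 (eta k - eta' k)).
have N2xi' k : N2 (xi' k) <= N2 (xi k).
  rewrite /xi' /truncate; case: ifP => _; first by rewrite N2_fcomb N2_ge.
  by rewrite N2_0 N2_ge0.
have ph p q (f f' : H) : 0 <= p -> 0 <= q -> 0 <= c * (p * N2 f + q * N2 f').
  move=> p0 q0; apply: mulr_ge0; first exact: ltW.
  by apply: addr_ge0; apply: mulr_ge0 => //; exact: N2_ge0.
have si0 : 0 <= s^-1 by rewrite invr_ge0 ltW.
have h0 k : 0 <= h k by rewrite addr_ge0// ph// ltW.
have gh k : normsq (inner (y (xi k)) (eta k) + -1 * inner (y (xi' k)) (eta' k)) <= h k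
  ^+ 2.
  have -> : inner (y (xi k)) (eta k) + -1 * inner (y (xi' k)) (eta' k) =
      inner (y (xi k - xi' k)) (eta k) + inner (y (xi' k)) (eta k - eta' k).
    by rewrite (linear_opB yl) innerBl innerBr; ring.
  have s0' := ltW s0; apply: normsqD_sq_le; [exact: ph|exact: ph|exact: inner_op_le|].
  have si1 : 0 < s^-1 by rewrite invr_gt0.
  apply: le_trans (inner_op_le _ _ si1 yc) _; rewrite invrK.
  rewrite ler_sqr ?nnegrE ?ph//; apply: ler_wpM2l; first exact: ltW.
  by rewrite lerD2r ler_wpM2l.
apply: (has_csum_normsq h3) => B; apply: le_trans (normsq_sum_sq_le B h0 gh) _.
have hs := has_sumD
  (has_sumZ c (has_sumD (has_sumZ s xs1) (has_sumZ s^-1 etaT)))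
  (has_sumZ c (has_sumD (has_sumZ s^-1 xiS) (has_sumZ s es2))).
have hB := has_sum_ge B h0 hs.
have e0' : 0 <= e * c by rewrite mulr_ge0 ?ltW.
rewrite ler_sqr ?nnegrE ?sumr_ge0//; apply: le_trans hB _.
have sS : s^-1 * (S + T) <= e / 2.
  rewrite /s invf_div mulrAC ler_pdivrMr ?ltr_wpDl ?addr_ge0// ler_wpM2l ?ltW//.
  by rewrite ltrDl.
have sd : s * d = e / 4 by rewrite /d mulrC divfK// gt_eqF.
have s1e : s * s1 <= e / 4 by rewrite -sd ler_wpM2l// ltW.
have s2e : s * s2 <= e / 4 by rewrite -sd ler_wpM2l// ltW.
rewrite -mulrDr [e * c]mulrC; apply: ler_wpM2l; first exact: ltW.
rewrite mulrDr in sS; move: s1e s2e sS.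
by move: (s * s1) (s * s2) (s^-1 * S) (s^-1 * T) => a1 a2 a3 a4 *; lra.
Qed.

End Predual.

(** * Norm closedness of the predual *)

Section PredualClosed.
Variables (R : realType) (J : choiceType).
Local Notation H := (l2 R J).
Local Notation C := R[i].
Implicit Types (x y : H -> H) (u : (H -> H) -> C).

Definition initial_fset (n : nat) : {fset nat} := [fset k in iota 0 n]%fset.

Lemma sum_initial_fset (V : nmodType) n (F : nat -> V) :
  \sum_(k <- initial_fset n) F k = \sum_(0 <= k < n) F k.
Proof.
rewrite /index_iota subn0; apply: perm_big; apply: uniq_perm => //.
  exact: iota_uniq.
by move=> k; rewrite !inE.
Qed.

Lemma sub_initial_fset (A : {fset nat}) : exists n, forall m, (n <= m)%N ->
  (A `<=` initial_fset m)%fset.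
Proof.
exists (\max_(k <- A) k).+1 => m nm; apply/fsubsetP => k kA.
rewrite !inE mem_iota /= add0n (leq_trans _ nm)// ltnS.
by rewrite (big_fsetD1 k)//= leq_maxl.
Qed.

Section Concatenation.
Variables (T : Type) (z0 : T) (L : nat -> seq T).

(** The separator [z0] makes each block nonempty, so stage [k.+1] already contains position [k]. It
    is the pair of zero vectors below and contributes nothing. *)
Fixpoint concat (K : nat) : seq T :=
  if K is K'.+1 then concat K' ++ z0 :: L K' else [::].

Definition concat_nth (k : nat) : T := nth z0 (concat k.+1) k.

Lemma concat_size K : (K <= size (concat K))%N.
Proof.
elim: K => [|K IH] //=; rewrite size_cat /= addnS ltnS.
exact: leq_trans IH (leq_addr _ _).
Qed.

Lemma concat_stable K K' k : (K <= K')%N -> (k < size (concat K))%N ->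
  nth z0 (concat K') k = nth z0 (concat K) k.
Proof.
move=> /subnK <-; elim: (K' - K)%N => [|i IH] //= kK.
rewrite nth_cat IH// (leq_trans kK)//.
elim: {IH}i => //= i IH; rewrite size_cat.
exact: leq_trans IH (leq_addr _ _).
Qed.

Lemma sum_concat_nth (V : nmodType) (G : T -> V) K : G z0 = 0 ->
  \sum_(k <- initial_fset (size (concat K))) G (concat_nth k) =
  \sum_(j < K) \sum_(p <- L j) G p.
Proof.
move=> G0; rewrite sum_initial_fset.
transitivity (\sum_(p <- concat K) G p).
  rewrite [RHS](big_nth z0); apply: eq_big_nat => k /andP[_ kK].
  congr G; case: (leqP K k.+1) => Kk; first exact: concat_stable.
  by rewrite /concat_nth -(concat_stable (ltnW Kk))//; exact: concat_size.
elim: K => [|K IH] /=; first by rewrite big_nil big_ord0.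
by rewrite big_cat/= IH big_ord_recr/= big_cons G0 add0r.
Qed.

End Concatenation.

(** The concatenated pairs are square summable, so the sum over all of them exists; its value is
    then read off along the ends of blocks, which are cofinal among the finite sets. *)
Lemma predual_pair_functionals u (L : nat -> seq (H * H)) (b : R) :
  (forall K, \sum_(j < K) \sum_(p <- L j) N2 p.1 <= b) ->
  (forall K, \sum_(j < K) \sum_(p <- L j) N2 p.2 <= b) ->
  (forall y, bounded_op y -> forall e : R, 0 < e -> \forall K \near \oo,
    normsq (u y - \sum_(j < K) pair_functional (L j) y) <= e ^+ 2) ->
  exists2 w, predual w & forall y, bounded_op y -> u y = w y.
Proof.
move=> L1 L2 uL; pose z := concat_nth ((0, 0) : H * H) L.
pose xi k := (z k).1; pose eta k := (z k).2.
have cofinal (f : nat -> R) : (forall k, 0 <= f k) ->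
    (forall K, \sum_(k <- initial_fset (size (concat (0, 0) L K))) f k <= b) ->
    exists S, has_sum f S.
  move=> f0 fb; apply: (bounded_has_sum (c := b)) => // A.
  have [n An] := sub_initial_fset A.
  by apply: le_trans (ler_sum_fset f0 (An _ (concat_size (0, 0) L n))) (fb n).
have N20 : N2 (0 : H) = 0 := N2_0 R J.
have [S xiS] : exists S, has_sum (fun k => N2 (xi k)) S.
  apply: cofinal => [k|K]; first exact: N2_ge0.
  by rewrite (@sum_concat_nth _ (0, 0) L _ (fun p : H * H => N2 p.1)).
have [T etaT] : exists T, has_sum (fun k => N2 (eta k)) T.
  apply: cofinal => [k|K]; first exact: N2_ge0.
  by rewrite (@sum_concat_nth _ (0, 0) L _ (fun p : H * H => N2 p.2)).
have zp := SquareSummablePairs xiS etaT.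
exists (fun y => csum (fun k => inner (y (xi k)) (eta k))).
  by apply/predualP; exists xi, eta.
move=> y yb; have [yl _] := yb.
have tot : initial_fset (size (concat (0, 0) L K)) @[K --> \oo] --> totally.
  move=> P [A _ AP]; have [n An] := sub_initial_fset A.
  by exists n => // K /= nK; apply: AP; apply: An;
    exact: leq_trans nK (concat_size _ _ _).
have vE K : \sum_(k <- initial_fset (size (concat (0, 0) L K))) inner (y (xi k)) (eta k) =
    \sum_(j < K) pair_functional (L j) y.
  rewrite (@sum_concat_nth _ (0, 0) L _ (fun p : H * H => inner (y p.1) p.2))//=.
  by rewrite (linear_op0 yl) -(scale0r 0) innerZl mul0r.
have [[h1] [h2]] := pairs_has_csum zp yb.
have {}h1 := cvg_comp _ _ tot h1; have {}h2 := cvg_comp _ _ tot h2.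
apply: complex_eq.
  apply: (cvg_unique (@norm_hausdorff R R) _ h1); apply/cvgrPdist_le => e e0.
  apply: filterS (uL y yb e e0) => K; rewrite -vE.
  by move=> /(normsq_ReIm_le (ltW e0))[+ _]; rewrite ReB Re_sum.
apply: (cvg_unique (@norm_hausdorff R R) _ h2); apply/cvgrPdist_le => e e0.
apply: filterS (uL y yb e e0) => K; rewrite -vE.
by move=> /(normsq_ReIm_le (ltW e0))[_]; rewrite ImB Im_sum.
Qed.

(* The predual is closed for the norm of functionals on [bounded_op]: write the
   limit as a telescoping series of matrix functionals of geometrically small
   norm, decompose each term, and concatenate. *)
Lemma approximable_predual u : matrix_approximable u ->
  exists2 w, predual w & forall y, bounded_op y -> u y = w y.
Proof.
move=> ua; pose h (j : nat) : R := 2^-1 ^+ j.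
have h0 j : 0 < h j by rewrite exprn_gt0// invr_gt0.
have /choice[D /choice[t vt]] : forall j, exists D, exists t, forall y c, 0 < c ->
    op_bound y c -> normsq (u y - matrix_functional D t y) <= (h j * c) ^+ 2.
  by move=> j; exact: ua (h0 j).
(* Starting from 0 makes the differences telescope to [v K] itself. *)
pose v j := if j is j'.+1 then matrix_functional (D j') (t j') else fun=> 0.
have /choice[E /choice[s vs]] : forall j, exists E, exists s, forall x,
    v j.+1 x - v j x = matrix_functional E s x.
  case=> [|j] /=; last exact: matrix_functionalB.
  by exists (D 0%N), (t 0%N) => x; rewrite subr0.
have [b0 b00 vb0] := matrix_functional_bound (E 0%N) (s 0%N).
(* [b0] covers the term of index 0. A later difference has norm at most [h j + h j.+1 = 3 * h j.+1],
   which 4 covers. *)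
pose b := b0 + 4.
have bh j : forall x, op_bound x 1 ->
    normsq (matrix_functional (E j) (s j) x) <= (b * h j) ^+ 2.
  move=> x xb; case: j => [|j].
    apply: le_trans (vb0 x xb) _; rewrite /h expr0 mulr1 ler_sqr ?nnegrE ?addr_ge0//.
    by rewrite lerDl.
  rewrite -vs; have hj := ltW (h0 j); have hj1 := ltW (h0 j.+1).
  have -> : v j.+2 x - v j.+1 x = (u x - v j.+1 x) + (-1) * (u x - v j.+2 x) by ring.
  have v1 := vt j x 1 ltr01 xb; have v2 := vt j.+1 x 1 ltr01 xb.
  rewrite !mulr1 in v1 v2.
  apply: le_trans (normsqD_sq_le hj hj1 v1 _) _.
    by rewrite mulN1r normsqN.
  rewrite ler_sqr ?nnegrE ?addr_ge0 ?mulr_ge0 ?addr_ge0//.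
  have -> : h j = 2 * h j.+1 by rewrite /h exprS mulrA mulfV ?mul1r.
  by rewrite /b; nra.
have /choice[L HL] : forall j, exists L : seq (H * H),
    [/\ forall x, linear x -> matrix_functional (E j) (s j) x = pair_functional L x,
        \sum_(p <- L) N2 p.1 <= b * h j & \sum_(p <- L) N2 p.2 <= b * h j].
  move=> j; apply: matrix_functional_pairs (bh j).
  by rewrite mulr_ge0 ?addr_ge0// ltW.
have b_ge0 : 0 <= b by rewrite addr_ge0.
have geo (f : nat -> R) K : (forall j, f j <= b * h j) -> \sum_(j < K) f j <= 2 * b.
  move=> fb; apply: (@le_trans _ _ (2 * b - 2 * b * h K)); last first.
    by rewrite gerBl mulr_ge0 ?mulr_ge0// ltW.
  elim: K => [|K IH]; first by rewrite big_ord0 /h expr0 mulr1 subrr.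
  rewrite big_ord_recr/=; have := fb K.
  have hK : h K = 2 * h K.+1 by rewrite /h exprS mulrA mulfV ?mul1r.
  by rewrite hK in IH *; lra.
apply: (@predual_pair_functionals u L (2 * b)).
- by move=> K; apply: (geo (fun j => \sum_(p <- L j) N2 p.1)) => j; have [] := HL j.
- by move=> K; apply: (geo (fun j => \sum_(p <- L j) N2 p.2)) => j; have [] := HL j.
move=> y yb e e0; have [c c0 yc] := bounded_op_bound yb; have [yl _] := yb.
have vE K : \sum_(j < K) pair_functional (L j) y = v K y.
  rewrite (eq_bigr (fun j : 'I_K => v j.+1 y - v j y)) => [|j _]; last first.
    by rewrite vs; have [->] := HL j.
  elim: K => [|K IH]; first by rewrite big_ord0.
  by rewrite big_ord_recr/= IH addrC subrK.
have hc : (h j * c) @[j --> \oo] --> 0.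
  rewrite -[X in _ --> X](mul0r c); apply: cvgM; last exact: cvg_cst.
  by apply: cvg_expr; rewrite ger0_norm ?invr_ge0// invf_lt1//; lra.
have /cvgrPdist_le/(_ e e0)[N _ HN] := hc.
exists N.+1 => // -[//|K] /= NK; rewrite vE; apply: le_trans (vt K y c c0 yc) _.
have hKc : 0 <= h K * c by rewrite mulr_ge0// ltW.
rewrite ler_sqr ?nnegrE//; last exact: ltW.
by have := HN K NK; rewrite /= sub0r normrN ger0_norm.
Qed.

End PredualClosed.

(** * The w*-topology and w*-continuity of Schur multipliers *)

Section WStar.
Variables (R : realType) (J : choiceType).
Local Notation H := (l2 R J).
Local Notation C := R[i].
Implicit Types (x y : H -> H).

Lemma wstar_cvg (F : set_system (H -> H)) (T : H -> H) : Filter F ->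
  (forall w : (H -> H) -> C^o, predual w -> w @ F --> w T) ->
  F --> (T : wstar R J).
Proof.
move=> FF FT U [_ [[W oW <-]] /= WT /filterS]; apply.
suff /(_ W) : (fun (T : H -> H) => (fun w : @predual R J => val w T) :
    prod_topology (fun _ : @predual R J => C^o)) @ F -->
    ((fun w : @predual R J => val w T) : prod_topology (fun _ : @predual R J => C^o)).
  by apply; exact: open_nbhs_nbhs.
apply/cvg_sup => w V [_ [[B oB <-]] /= BT /filterS]; apply.
have := FT _ (set_valP w); apply; exact: open_nbhs_nbhs.
Qed.

Lemma prod_coordinate_continuous (I : Type) (K : I -> topologicalType) (i : I) :
  continuous (fun f : prod_topology K => f i).
Proof.
move=> f U Uf; have /cvg_sup/(_ i) : nbhs f --> (f : prod_topology K) by [].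
by apply; exact: (@initial_continuous _ _ (fun f : forall i, K i => f i) f U Uf).
Qed.

Lemma predual_continuous (w : (H -> H) -> C^o) : predual w ->
  continuous (w : wstar R J -> C^o).
Proof.
move=> pw T U wU; have h := @initial_continuous _ _ (fun (T : H -> H) =>
  (fun w : @predual R J => val w T) : prod_topology (fun _ : @predual R J => C^o)) T.
exact: (h _ (@prod_coordinate_continuous _ (fun _ : @predual R J => C^o)
  (exist _ w (mem_set pw)) _ _ wU)).
Qed.

Lemma wstar_continuous_onP (A : set (H -> H)) (S : (H -> H) -> H -> H) :
  wstar_continuous_on A S <-> forall x, A x ->
    S @ within A (nbhs (x : wstar R J)) --> (S x : wstar R J).
Proof. exact: subspace_continuousP. Qed.

Section SchurWStar.
Variables (k : J -> J -> C) (c : R).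
Hypotheses (c0 : 0 <= c) (kc : schur_bound k c).

Lemma predual_schur (w : (H -> H) -> C^o) : predual w ->
  exists2 w' : (H -> H) -> C^o, predual w' &
    forall y, bounded_op y -> w (schur k y) = w' y.
Proof.
move=> /predual_approximable wa; apply: approximable_predual => e e0.
have c1 : 0 < c + 1 by rewrite ltr_wpDl.
(* [c] may be 0, hence the denominator [c + 1]. The transpose of the Schur multiplier only
   multiplies the matrix of the functional by [k] entrywise. *)
have [D [t wt]] := wa (e / (c + 1)) (divr_gt0 e0 c1).
exists D, (fun m n => t m n * k m n) => y b b0 yb.
have yb' := op_bound_bounded yb.
have sb : op_bound (schur k y) ((c + 1) * b).
  have [sl _ sb] := schur_op_bound c0 kc b0 yb; split => //.
    by rewrite mulr_ge0// ltW.
  move=> xi; apply: le_trans (sb xi) _; rewrite ler_wpM2r ?N2_ge0//.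
  by rewrite ler_sqr ?nnegrE ?mulr_ge0// ?ltW// ltr_pM2r// ltrDl.
have := wt _ _ (mulr_gt0 c1 b0) sb; rewrite mulrA divfK ?gt_eqF//.
congr (normsq (_ - _) <= _); apply: eq_bigr => m _; apply: eq_bigr => n _.
by rewrite (schur_delta kc)// mulrA.
Qed.

(** Composing a predual functional with [schur k] agrees with a predual functional on bounded
    operators, hence continuity within [bounded_op]. *)
Lemma schur_wstar_continuous : wstar_continuous_on (@bounded_op R J) (schur k).
Proof.
apply/wstar_continuous_onP => x xb; apply: wstar_cvg => w pw.
have [w' pw' ww'] := predual_schur pw.
move=> B; rewrite /= ww'// => wB.
have h : nbhs (x : wstar R J) (w' @^-1` B) := predual_continuous pw' wB.
suff : nbhs (x : wstar R J) (fun y => bounded_op y -> B (w (schur k y))) by [].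
by apply: filterS h => y By yb; rewrite ww'.
Qed.

Lemma schurB x y : bounded_op x -> bounded_op y ->
  schur k (x - y) = schur k x - schur k y.
Proof.
move=> xb yb; rewrite -[x - y]addrC -scaleN1r (schur_linear_comb c0 kc)//.
by rewrite scaleN1r addrC.
Qed.

Lemma schur_wstar_closure (A : set (H -> H)) x : A `<=` @bounded_op R J ->
  (forall y, A y -> A (schur k y)) ->
  wstar_closure A x -> wstar_closure A (schur k x).
Proof.
move=> Ab Ak [xb xA]; refine (conj (schur_bounded c0 kc xb) _).
move=> B /(iffLR (wstar_continuous_onP _ _) schur_wstar_continuous x xb) SB.
have [y [Ay yB]] := xA _ SB; exists (schur k y); split; first exact: Ak.
by apply: yB; exact: Ab.
Qed.

Lemma schur_norm_closure (A : set (H -> H)) x : A `<=` @bounded_op R J ->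
  (forall y, A y -> A (schur k y)) ->
  norm_closure A x -> norm_closure A (schur k x).
Proof.
move=> Ab Ak [xb xA]; refine (conj (schur_bounded c0 kc xb) _).
move=> e e0; have c1 : 0 < c + 1 by rewrite ltr_wpDl.
have d0 : 0 < e / (c + 1) by rewrite divr_gt0.
have [y Ay xy] := xA _ d0; exists (schur k y); first exact: Ak.
have yb := Ab _ Ay; have xyb := bounded_opB xb yb.
rewrite -schurB//.
have /(schur_op_bound c0 kc d0)/op_bound_opnorm/le_trans : op_bound (x - y) (e / (c + 1)).
  by apply: opnorm_op_bound => //; case: xyb.
apply; rewrite lee_fin mulrA ler_pdivrMr// mulrC ler_wpM2l ?lerDl//.
exact: ltW.
Qed.

End SchurWStar.

End WStar.

(** * The quantum torus *)

Section Monomials.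
Variables (R : realType) (d : nat) (theta : 'M[R]_d).
Local Notation Zd := 'rV[int]_d.
Local Notation H := (l2 R Zd).
Local Notation C := R[i].
Implicit Types (m n p q : Zd) (xi : H).

Lemma wshiftE (t : Zd -> R) m xi p : wshift t m xi p = expi (t p) * xi (p - m).
Proof. by []. Qed.

Lemma eq_wshift (s t : Zd -> R) m xi : s =1 t -> wshift s m xi = wshift t m xi.
Proof. by move=> st; apply: l2P => p; rewrite !wshiftE st. Qed.

Lemma wshift_wshift (s t : Zd -> R) m n xi :
  wshift s m (wshift t n xi) = wshift (fun p => s p + t (p - m)) (m + n) xi.
Proof. by apply: l2P => p; rewrite !wshiftE mulrA -expiD opprD addrA. Qed.

Lemma wshift0 xi : wshift (fun=> 0) 0 xi = xi.
Proof. by apply: l2P => p; rewrite wshiftE expi0 mul1r subr0. Qed.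

Lemma N2_wshift (t : Zd -> R) m xi : N2 (wshift t m xi) = N2 xi.
Proof. by rewrite -!l2norm_sq l2norm_wshift. Qed.

Lemma phaseD k m n : phase theta k (m + n) = phase theta k m + phase theta k n.
Proof.
rewrite /phase -mulrDr -big_split/=; congr (_ * _); apply: eq_bigr => j _.
by rewrite mxE rmorphD mulrDr.
Qed.

Lemma phaseZ k (z : int) n : phase theta k (z *: n) = z%:~R * phase theta k n.
Proof.
rewrite /phase [RHS]mulrCA; congr (_ * _); rewrite mulr_sumr; apply: eq_bigr => j _.
by rewrite mxE rmorphM mulrCA.
Qed.

Lemma phaseN k n : phase theta k (- n) = - phase theta k n.
Proof. by rewrite -scaleN1r phaseZ mulN1r. Qed.

Lemma phase_delta (k l : 'I_d) : (k <= l)%N -> phase theta k (delta_mx 0 l) = 0.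
Proof.
move=> kl; rewrite /phase big1 ?mulr0// => j jk; rewrite mxE/=.
by case: eqVneq => [jl|]; rewrite ?mulr0//; move: jk; rewrite jl ltnNge kl.
Qed.

(** [phase k] sees only the coordinates below [k], so moving along [delta_mx 0 k] does not change it
    and the phases of successive factors add up. *)
Lemma generator_pow_wshift (k : 'I_d) (z : int) xi :
  generator_pow theta k z xi =
  wshift (fun p => z%:~R * phase theta k p) (z *: delta_mx 0 k) xi.
Proof.
have ph a p : phase theta k (p - a *: delta_mx 0 k) = phase theta k p.
  by rewrite phaseD phaseN phaseZ phase_delta// mulr0 subr0.
case: z => [j|j]; rewrite /generator_pow.
  elim: j => [|j IH] /=.
    by rewrite -[LHS]wshift0 scale0r; apply: eq_wshift => p; rewrite mul0r.
  rewrite IH /generator wshift_wshift; apply: l2P => p; rewrite !wshiftE.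
  rewrite -{1 2}[delta_mx 0 k]scale1r ph -scalerDl -intS; congr (expi _ * _).
  by rewrite intS rmorphD/= mulrDl mul1r.
rewrite NegzE; elim: j.+1 => [|i IH] /=.
  by rewrite -[LHS]wshift0 oppr0 scale0r; apply: eq_wshift => p; rewrite mul0r.
rewrite IH /generator_inv wshift_wshift; apply: l2P => p; rewrite !wshiftE.
have -> : phase theta k (p - - delta_mx 0 k) = phase theta k p.
  by rewrite opprK phaseD phase_delta// addr0.
congr (expi _ * xi (p - _)).
  by rewrite !rmorphN/= intS rmorphD/=; ring.
by rewrite intS opprD scalerDl scaleN1r.
Qed.

(** The exponent of the cocycle of the twisted group algebra: moving [U^n] past [U^m] into standard
    order costs the phase [expi (bil m n)], see [monomialM]. *)
Definition bil m n : R := \sum_k (m 0 k)%:~R * phase theta k n.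

Lemma bilDl m m' n : bil (m + m') n = bil m n + bil m' n.
Proof.
by rewrite /bil -big_split; apply: eq_bigr => k _; rewrite mxE rmorphD mulrDl.
Qed.

Lemma bilDr m n n' : bil m (n + n') = bil m n + bil m n'.
Proof. by rewrite /bil -big_split; apply: eq_bigr => k _; rewrite phaseD mulrDr. Qed.

Lemma bil0r m : bil m 0 = 0.
Proof. by apply: (@addrI _ (bil m 0)); rewrite -bilDr !addr0. Qed.

Lemma monomialE m xi p : monomial theta m xi p = expi (bil m (p - m)) * xi (p - m).
Proof.
have srt : sorted (relpre val ltn) (index_enum 'I_d).
  by rewrite -sorted_map -[index_enum _]enumT val_enum_ord iota_ltn_sorted.
pose M (s : seq 'I_d) : Zd := \sum_(k <- s) m 0 k *: delta_mx 0 k.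
have ME : m = M (index_enum 'I_d) by exact: row_sum_delta.
suff E s : sorted (relpre val ltn) s -> forall xi,
    (\big[comp/id]_(k <- s) generator_pow theta k (m 0 k)) xi =
    wshift (fun p => \sum_(k <- s) (m 0 k)%:~R * phase theta k (p - M s)) (M s) xi.
  by rewrite /monomial E// wshiftE -ME.
elim: s => [|k s IH] /= ps eta.
  rewrite big_nil -[LHS]wshift0 /M big_nil.
  by apply: eq_wshift => q; rewrite big_nil.
rewrite big_cons /= (IH (path_sorted ps)) generator_pow_wshift wshift_wshift.
have -> : M (k :: s) = m 0 k *: delta_mx 0 k + M s by rewrite /M big_cons.
apply: eq_wshift => q; rewrite big_cons.
congr (_ + _); last by apply: eq_bigr => l _; rewrite opprD addrA.
(* By sortedness the remaining shift [M s] involves only coordinates above [k], on which [phase k]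
   vanishes. *)
rewrite opprD !phaseD !phaseN phaseZ phase_delta// mulr0 oppr0 add0r.
rewrite [phase theta k (M s)](_ : _ = 0) ?subr0//.
have tr : transitive (relpre (@nat_of_ord d) ltn) by move=> a b c; apply: ltn_trans.
rewrite /M (big_morph (phase theta k) (phaseD k) (id1 := 0)); last first.
  by rewrite -(scale0r 0) phaseZ mul0r.
rewrite big_seq big1// => l ls; rewrite phaseZ phase_delta ?mulr0//.
by have /allP/(_ l ls)/= := order_path_min tr ps; exact: ltnW.
Qed.

Lemma monomial_wshift m xi :
  monomial theta m xi = wshift (fun p => bil m (p - m)) m xi.
Proof. by apply: l2P => p; rewrite monomialE. Qed.

Lemma monomialM m n xi : monomial theta m (monomial theta n xi) =
  expi (bil m n) *: monomial theta (m + n) xi.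
Proof.
apply: l2P => p; rewrite l2Z !monomialE !mulrA -!expiD opprD addrA.
congr (expi _ * _); rewrite bilDl [RHS]addrA -bilDr; congr (bil m _ + _).
by rewrite [RHS]addrC subrK.
Qed.

Lemma monomial_surj m xi : exists2 eta, N2 eta = N2 xi & monomial theta m eta = xi.
Proof.
exists (wshift (fun p => - bil m p) (- m) xi); first exact: N2_wshift.
apply: l2P => p; rewrite monomialE wshiftE mulrA -expiD subrr expi0 mul1r.
by rewrite opprK subrK.
Qed.

Lemma N2_monomial m xi : N2 (monomial theta m xi) = N2 xi.
Proof. by rewrite monomial_wshift N2_wshift. Qed.

Lemma monomial_linear m : linear (monomial theta m).
Proof.
move=> a xi eta; apply: l2P => p; rewrite monomialE.
transitivity (a * monomial theta m xi p + monomial theta m eta p) => //.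
rewrite !monomialE.
transitivity (expi (bil m (p - m)) * (a * xi (p - m) + eta (p - m))) => //.
by ring.
Qed.

Lemma monomial_op_bound m : op_bound (monomial theta m) 1.
Proof.
split => //; first exact: monomial_linear.
by move=> xi; rewrite N2_monomial expr1n mul1r.
Qed.

Lemma monomial_bounded m : bounded_op (monomial theta m).
Proof. exact: op_bound_bounded (monomial_op_bound m). Qed.

Lemma monomial_entry m n q : monomial theta m (delta R n) q =
  expi (bil (q - n) n) * (q == m + n)%:R.
Proof.
rewrite monomialE /= subr_eq [n + m]addrC.
by case: eqVneq => [->|]; rewrite ?mulr0// addrK [m + n]addrC addrK.
Qed.

End Monomials.

(** * Polynomials and their two closures *)

Section Polynomials.
Variables (R : realType) (d : nat) (theta : 'M[R]_d).
Local Notation Zd := 'rV[int]_d.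
Local Notation H := (l2 R Zd).
Local Notation C := R[i].
Implicit Types (m n p q : Zd) (xi : H) (x y : H -> H).

Lemma polynomials_sum (I : eqType) (r : seq I) (f : I -> Zd) (c : I -> C) :
  polynomials theta (\sum_(i <- r) c i *: monomial theta (f i)).
Proof.
exists (undup (map f r)), (fun m => \sum_(i <- r | f i == m) c i).
under [RHS]eq_bigr do rewrite scaler_suml big_mkcond.
rewrite exchange_big/=; apply: eq_big_seq => i ir.
rewrite (bigD1_seq (f i)) ?undup_uniq ?mem_undup ?map_f//= eqxx.
by rewrite big1 ?addr0// => m; rewrite eq_sym => /negbTE ->.
Qed.

Lemma polynomials_monomial c m : polynomials theta (c *: monomial theta m).
Proof. by have := polynomials_sum [:: m] id (fun=> c); rewrite big_seq1. Qed.

Lemma polynomials_bounded : polynomials theta `<=` @bounded_op R Zd.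
Proof.
by move=> _ [s [a ->]]; apply: bounded_op_sum => m; exact: monomial_bounded.
Qed.

Lemma polynomials_entry x n q : polynomials theta x ->
  x (delta R n) q = expi (bil theta (q - n) n) * x (delta R 0) (q - n).
Proof.
move=> [s [a ->]]; rewrite !op_sumE !l2_sum mulr_sumr; apply: eq_bigr => m _.
transitivity (a m * monomial theta m (delta R n) q) => //.
transitivity (expi (bil theta (q - n) n) * (a m * monomial theta m (delta R 0) (q -
  n))) => //.
rewrite !monomial_entry bil0r expi0 mul1r addr0 subr_eq.
by rewrite mulrCA.
Qed.

Lemma fourier_coefE x m : fourier_coef theta x m = x (delta R 0) m.
Proof. by rewrite /fourier_coef monomial_delta0 inner_deltar. Qed.

Lemma polynomials_Atheta : polynomials theta `<=` Atheta theta.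
Proof.
move=> x px; have xb := polynomials_bounded px; refine (conj xb _) => e e0.
exists x => //; rewrite subrr; apply: op_bound_opnorm; split; rewrite ?ltW//.
  exact: bounded_op_linear (bounded_op0 R Zd).
move=> xi; rewrite -[(0 : H -> H) xi]/(0 : H) N2_0.
by rewrite mulr_ge0 ?sqr_ge0 ?N2_ge0.
Qed.

Lemma Atheta_bounded : Atheta theta `<=` @bounded_op R Zd.
Proof. by move=> x []. Qed.

Lemma Linf_bounded : Linf theta `<=` @bounded_op R Zd.
Proof. by move=> x []. Qed.

Lemma polynomials_Linf : polynomials theta `<=` Linf theta.
Proof.
move=> x px; refine (conj (polynomials_bounded px) _).
exact/subset_closure/polynomials_Atheta.
Qed.

(** A matrix functional within distance 1 of [w] is bounded on the unit ball; the general case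
    follows by scaling [y]. *)
Lemma predual_bound (w : (H -> H) -> C^o) : predual w -> exists2 c, 0 <= c &
  forall y b, 0 < b -> op_bound y b -> normsq (w y) <= (c * b) ^+ 2.
Proof.
move=> pw; have [D [t wt]] := predual_approximable pw ltr01.
have [c c0 tc] := matrix_functional_bound D t.
exists (1 + c); first exact: addr_ge0.
move=> y b b0 yb; have bC : b%:C != 0 :> C by rewrite eq_complex /= eqxx andbT gt_eqF.
have [yl _ ybb] := yb.
rewrite -[w y](subrK (matrix_functional D t y)) mulrDl.
apply: normsqD_sq_le; [by rewrite mul1r ltW|by rewrite mulr_ge0// ltW|exact: wt|].
have y1 : op_bound (b%:C^-1 *: y) 1.
  split => //.
    move=> a xi eta; rewrite -![(b%:C^-1 *: y) _]/(b%:C^-1 *: y _) yl.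
    by rewrite scalerDr !scalerA mulrC.
  move=> xi; rewrite -[(b%:C^-1 *: y) _]/(b%:C^-1 *: y xi) N2Z expr1n mul1r.
  have -> : normsq (b%:C^-1 : C) = (b ^+ 2)^-1.
    by rewrite -rmorphV ?unitfE ?gt_eqF//= normsq_real exprVn.
  by rewrite ler_pdivrMl ?exprn_gt0.
have -> : matrix_functional D t y = b%:C * matrix_functional D t (b%:C^-1 *: y).
  rewrite /matrix_functional mulr_sumr; apply: eq_bigr => m _.
  rewrite mulr_sumr; apply: eq_bigr => n _.
  transitivity (b%:C * (t m n * (b%:C^-1 * y (delta R n) m))) => //.
  by field.
rewrite normsqM normsq_real exprMn mulrC ler_wpM2r ?sqr_ge0//; exact: tc.
Qed.

Lemma predualB (w : (H -> H) -> C^o) x y : predual w ->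
  bounded_op x -> bounded_op y -> w (x - y) = w x - w y.
Proof.
move=> /predualP[xi [eta [zp ->]]] xb yb.
have xyb := bounded_opB xb yb.
apply: has_csum_unique (pairs_has_csum zp xyb) _.
rewrite -[csum _ - _]addrC -mulN1r.
apply: (eq_has_csum _ (has_csumD (has_csumZ (-1) (pairs_has_csum zp yb))
  (pairs_has_csum zp xb))) => k.
by rewrite -[(x - y) (xi k)]/(x (xi k) - y (xi k)) innerBl addrC mulN1r.
Qed.

Lemma norm_closure_wstar (A : set (H -> H)) : A `<=` @bounded_op R Zd ->
  norm_closure A `<=` closure (A : set (wstar R Zd)).
Proof.
move=> Ab x [xb xA].
have h0 j : 0 < j.+1%:R^-1 :> R by rewrite invr_gt0.
have /choice[f ff] : forall j, exists y, A y /\ (opnorm (x - y)%R <= (j.+1%:R^-1)%:E)%E.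
  by move=> j; have [y Ay xy] := xA _ (h0 j); exists y.
have fx : f @ \oo --> (x : wstar R Zd).
  apply: wstar_cvg => w pw; have [c c0 wc] := predual_bound pw.
  (* The radius [e] is a positive complex number, so its imaginary part is 0. *)
  apply/cvgrPdist_le => e; rewrite ltcE => /andP[/= /eqP e_im e0].
  have /cvgrPdist_le/(_ _ e0)[N _ HN] : (c * j.+1%:R^-1) @[j --> \oo] --> (0 : R).
    by rewrite -[X in _ --> X](mulr0 c); apply: cvgM;
      [exact: cvg_cst|exact: cvg_harmonic].
  exists N => // j /= Nj; have [Afj xfj] := ff j.
  have xyb := bounded_opB xb (Ab _ Afj).
  rewrite -(predualB pw xb (Ab _ Afj)).
  have := wc _ _ (h0 j) (opnorm_op_bound (bounded_op_linear xyb) xfj).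
  have cj : 0 <= c * j.+1%:R^-1 by rewrite mulr_ge0// ltW.
  rewrite normc_def -/(normsq _) => wle; rewrite lecE /= -e_im eqxx /=.
  apply: (@le_trans _ _ (c * j.+1%:R^-1)).
    by rewrite -(ler_sqr (sqrtr_ge0 _)) ?nnegrE// sqr_sqrtr ?normsq_ge0.
  by have := HN j Nj; rewrite sub0r normrN ger0_norm.
move=> B /fx [N _ NB]; exists (f N); split; first by case: (ff N).
exact: NB (leqnn N).
Qed.

(** [Linf] is a w*-closure of a norm closure; norm limits are w*-limits and w*-closure is
    idempotent. *)
Lemma Linf_closure_polynomials :
  Linf theta `<=` closure (polynomials theta : set (wstar R Zd)).
Proof.
move=> x [_]; have := @closure_subset (wstar R Zd) _ _ (norm_closure_wstar
  polynomials_bounded).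
rewrite -[X in _ `<=` X](closure_id _).1; last exact: closed_closure.
by apply.
Qed.

Lemma vector_functional_predual (xi eta : H) :
  predual ((fun T => inner (T xi) eta) : (H -> H) -> C^o).
Proof.
have single (f : H) : has_sum (fun k : nat => N2 (if k == 0%N then f else 0)) (N2 f).
  have := @has_sum_fset R nat [fset 0%N]%fset (fun k => N2 (if k == 0%N then f else 0)).
  by rewrite big_seq_fset1 eqxx; apply => k; rewrite inE => /negbTE ->; exact: N2_0.
apply/predualP; exists (fun k => if k == 0%N then xi else 0), (fun k => if k == 0%N
  then eta else 0).
split; first exact: (SquareSummablePairs (single xi) (single eta)).
apply/funext => T; set f := fun k : nat => inner _ _.
have fk k : k \notin [fset 0%N]%fset -> f k = 0.
  by rewrite inE /f => /negbTE ->; rewrite inner_conj -(scale0r 0) innerZl mul0r conjc0.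
have f0 := has_csum_fset fk; rewrite big_seq_fset1 /f eqxx -/f in f0.
have [h1 h2] := f0.
have fS : has_csum f (csum f).
  pose g k : R := if k == 0%N then `|complex.Re (f 0%N)| + `|complex.Im (f 0%N)| else 0.
  have gS : has_sum g (g 0%N).
    have := @has_sum_fset R nat [fset 0%N]%fset g; rewrite big_seq_fset1; apply => k.
    by rewrite inE /g => /negbTE ->.
  apply: dominated_has_csum gS _ _ => k; rewrite /g; case: eqVneq => [->|k0].
  - by rewrite lerDl.
  - by rewrite fk ?inE// normr0.
  - by rewrite lerDr.
  - by rewrite fk ?inE// normr0.
exact: has_csum_unique f0 fS.
Qed.

End Polynomials.

(** * Multipliers and Schur multipliers *)

Section MultiplierToSchur.
Variables (R : realType) (d : nat) (theta : 'M[R]_d).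
Local Notation Zd := 'rV[int]_d.
Local Notation H := (l2 R Zd).
Local Notation C := R[i].
Implicit Types (m n p q : Zd) (xi : H) (x y : H -> H) (phi : Zd -> C)
  (S : (H -> H) -> H -> H).

Definition toeplitz phi m n : C := phi (m - n).

Lemma extension_polynomial_entry phi S x n q :
  extends_multiplier theta phi S -> polynomials theta x ->
  S x (delta R n) q = toeplitz phi q n * x (delta R n) q.
Proof.
move=> [_ _ _ Sp] px; have [pSx Sf] := Sp x px.
rewrite (polynomials_entry n q pSx) (polynomials_entry n q px).
by have := Sf (q - n); rewrite !fourier_coefE => ->; rewrite mulrCA.
Qed.

(** Both sides depend w*-continuously on [x] in [Linf] and agree on polynomials, which are
    w*-dense. *)
Lemma extension_entry phi S x n q :
  extends_multiplier theta phi S -> Linf theta x ->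
  S x (delta R n) q = toeplitz phi q n * x (delta R n) q.
Proof.
move=> ext Lx; have [SL _ Sc _] := ext.
have xc := Linf_closure_polynomials Lx.
pose w1 := (fun T => inner (T (delta R n)) (delta R q)) : (H -> H) -> C^o.
(* The scalar is put into the second vector, which makes [w2] a vector functional. *)
pose w2 := (fun T => inner (T (delta R n)) (conjc (toeplitz phi q n) *: delta R q))
  : (H -> H) -> C^o.
have pw1 : predual w1 := vector_functional_predual _ _.
have pw2 : predual w2 := vector_functional_predual _ _.
have w2E T : w2 T = toeplitz phi q n * T (delta R n) q.
  by rewrite /w2 inner_conj innerZl conjcM conjcK -inner_conj inner_deltar.
rewrite -w2E -[S x (delta R n) q]inner_deltar -/(w1 (S x)).
have FF : ProperFilter (within (polynomials theta) (nbhs (x : wstar R Zd))).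
  exact: (@within_nbhs_proper (wstar R Zd) _ _ xc).
have c1 : (fun T => w1 (S T)) @ within (polynomials theta) (nbhs (x : wstar R Zd)) -->
  w1 (S x).
  have := iffLR (wstar_continuous_onP _ _) Sc x Lx.
  move=> Sx B /(predual_continuous pw1) /Sx h.
  have {}h : nbhs (x : wstar R Zd) (fun T => Linf theta T -> B (w1 (S T))) := h.
  suff : nbhs (x : wstar R Zd) (fun T => polynomials theta T -> B (w1 (S T))) by [].
  by apply: filterS h => T h /polynomials_Linf.
have c2 : (fun T => w1 (S T)) @ within (polynomials theta) (nbhs (x : wstar R Zd)) -->
  w2 x.
  move=> B /(predual_continuous pw2) h.
  have {}h : nbhs (x : wstar R Zd) (w2 @^-1` B) := h.
  suff : nbhs (x : wstar R Zd) (fun T => polynomials theta T -> B (w1 (S T))) by [].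
  apply: filterS h => T BT pT.
  by rewrite /w1 inner_deltar (extension_polynomial_entry _ _ ext)// -w2E.
exact: (cvg_unique (@norm_hausdorff C C^o) c1 c2).
Qed.

(** The scalar inequality holds at each coordinate; summing over coordinates gives it for vectors of
    [H]. *)
Lemma contraction_l2 (I : finType) (a : I -> I -> C) (F : I -> H) :
  contraction a -> \sum_i N2 (\sum_j a i j *: F j) <= \sum_j N2 (F j).
Proof.
move=> ac; apply: (has_sum_le (has_sum_sum _ (fun i => N2_has_sum (\sum_j a i j *: F j)))
  (has_sum_sum _ (fun i => N2_has_sum (F i)))) => p.
by under eq_bigr do rewrite l2_sum; exact: ac.
Qed.

Lemma schur_bound_ord (J : choiceType) (k : J -> J -> C) (c : R) :
  (forall (n : nat) (r : 'I_n.+1 -> J) (a : 'I_n.+1 -> 'I_n.+1 -> C), contraction a ->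
    forall v, \sum_i normsq (\sum_j k (r i) (r j) * a i j * v j) <=
      c ^+ 2 * \sum_j normsq (v j)) ->
  schur_bound k c.
Proof.
move=> h I r a ac v; case E : #|I| => [|n].
  rewrite big1 => [|i _]; last by have := fintype0 i E.
  by rewrite mulr_ge0 ?sqr_ge0// sumr_ge0// => i _; exact: normsq_ge0.
pose f (i : 'I_n.+1) : I := enum_val (cast_ord (esym E) i).
have fb : bijective f.
  exists (fun i => cast_ord E (enum_rank i)) => i.
    by rewrite /f enum_valK cast_ordKV.
  by rewrite /f cast_ordK enum_rankK.
have re (V : nmodType) (F : I -> V) : \sum_i F i = \sum_i F (f i).
  by apply: reindex; exact: onW_bij.
rewrite !re; under eq_bigr do rewrite re.
apply: (h n (r \o f) (fun i j => a (f i) (f j))) => u.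
have [g fK gK] := fb; have := ac (u \o g); rewrite !re/=.
under eq_bigr do rewrite re.
under [X in _ <= X -> _]eq_bigr do rewrite /= fK.
by congr (_ <= _); apply: eq_bigr => i _; congr normsq; apply: eq_bigr => j _;
  rewrite /= fK.
Qed.

(* The matrix [X] below is the conjugate of [a] by the unitary
   [diag (U^(r i))]. *)
Lemma cb_norm_schur_bound phi S (c : R) : 0 <= c ->
  extends_multiplier theta phi S -> (cb_norm (Linf theta) S <= c%:E)%E ->
  schur_bound (toeplitz phi) c.
Proof.
move=> c0 ext Sc; apply: schur_bound_ord => n r a ac v.
(* The phase cancels the cocycle, so that [X i j] is [a i j] times [U^(r i)] times the adjoint of
   [U^(r j)]. *)
pose X : 'M[H -> H]_n.+1 := \matrix_(i, j)
  ((a i j * expi (- bil theta (r i - r j) (r j))) *: monomial theta (r i - r j)).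
have XP i j : polynomials theta (X i j) by rewrite mxE; exact: polynomials_monomial.
have XL i j : Linf theta (X i j) by exact: polynomials_Linf.
have XU i j eta : X i j (monomial theta (r j) eta) = a i j *: monomial theta (r i) eta.
  rewrite mxE.
  transitivity ((a i j * expi (- bil theta (r i - r j) (r j))) *:
    monomial theta (r i - r j) (monomial theta (r j) eta)) => //.
  by rewrite monomialM scalerA -mulrA -expiD addNr expi0 mulr1 subrK.
have X1 : (mx_opnorm X <= 1%:E)%E.
  apply/mx_opnorm_leP => // [i j|xi].
    exact/bounded_op_linear/(polynomials_bounded (XP i j)).
  have /choice[F FP] : forall j, exists eta, N2 eta = N2 (xi j) /\
      monomial theta (r j) eta = xi j.
    by move=> j; have [eta] := monomial_surj theta (r j) (xi j); exists eta.
  rewrite expr1n mul1r.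
  rewrite (eq_bigr (fun i => N2 (\sum_j a i j *: F j))) => [|i _].
    rewrite [leRHS](eq_bigr (fun j => N2 (F j))) => [|j _]; last by have [->] := FP j.
    exact: contraction_l2.
  rewrite -[RHS](N2_monomial theta (r i)) (linear_op_sum (monomial_linear theta (r i))).
  congr N2; apply: eq_bigr => j _; have [_ <-] := FP j.
  by rewrite XU (linear_opZ (monomial_linear theta (r i))).
have Sc' : (mx_opnorm (map_mx S X) <= c%:E)%E.
  apply: le_trans Sc; apply: (@le_trans _ _ (amplification_norm (Linf theta) S n.+1)).
    by apply: ereal_sup_ubound; exists X.
  by apply: ereal_sup_ubound; exists n.
have [SL _ _ _] := ext.
have SX i j : linear (map_mx S X i j) by rewrite mxE;
  exact/bounded_op_linear/Linf_bounded/SL.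
(* On these vectors row [i] of the image is a multiple of [delta R (r i)], whose coefficient is the
   [i]-th entry of the Schur product applied to [v]. *)
have := iffLR (mx_opnorm_leP SX c0) Sc' (fun j => v j *: delta R (r j)).
have SXd i j : map_mx S X i j (delta R (r j)) = (toeplitz phi (r i) (r j) * a i j) *:
  delta R (r i).
  apply: l2P => q; rewrite mxE (extension_polynomial_entry _ _ ext)//.
  have := XU i j (delta R 0); rewrite !monomial_delta0 => ->.
  rewrite !l2Z /=; case: eqVneq => [->|_]; last by rewrite !mulr0.
  by rewrite mulrA.
rewrite [in leRHS](eq_bigr (fun j => normsq (v j))) => [|j _];
  last by rewrite N2Z N2_delta mulr1.
congr (_ <= _); apply: eq_bigr => i _.
rewrite [mx_act _ _ _](_ : _ = (\sum_j toeplitz phi (r i) (r j) * a i j * v j) *: delta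
  R (r i)).
  by rewrite N2Z N2_delta mulr1.
rewrite scaler_suml; apply: eq_bigr => j _.
by rewrite (linear_opZ (SX i j)) SXd scalerA mulrC.
Qed.

End MultiplierToSchur.

(** * The commutative torus: from the norm to the Schur bound *)

Section Torus.
Variables (R : realType) (d : nat).
Local Notation Zd := 'rV[int]_d.
Local Notation H := (l2 R Zd).
Local Notation C := R[i].
Implicit Types (m n p q : Zd) (xi : H) (x y : H -> H) (phi : Zd -> C)
  (S : (H -> H) -> H -> H).
Local Notation T0 := (0 : 'M[R]_d).

Lemma bil0 m n : bil T0 m n = 0.
Proof.
rewrite /bil big1// => k _; rewrite /phase big1 ?mulr0// => j _.
by rewrite mxE mul0r.
Qed.

Lemma monomial0E m xi p : monomial T0 m xi p = xi (p - m).
Proof. by rewrite monomialE bil0 expi0 mul1r. Qed.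

Definition lattice_point (K : nat) (g : {ffun 'I_d -> 'I_K}) : Zd :=
  \row_k (g k : nat)%:Z.

(** These cubes are the Følner sets that witness the amenability of the lattice. *)
Definition box (K : nat) : {fset Zd} :=
  [fset lattice_point g | g in {: {ffun 'I_d -> 'I_K}}]%fset.

Lemma lattice_point_inj K : injective (@lattice_point K).
Proof.
move=> g h /rowP gh; apply/ffunP => k; apply: val_inj.
by have := gh k; rewrite !mxE => -[].
Qed.

Lemma in_box K p : (forall k, 0 <= p 0 k < K%:Z) -> p \in box K.
Proof.
move=> pK; have pk k : (`|p 0%R k|%N < K)%N.
  by have /andP[p0 pl] := pK k; rewrite -ltz_nat gez0_abs.
apply/imfsetP; exists [ffun k => Ordinal (pk k)] => //.
apply/rowP => k; rewrite mxE ffunE /= gez0_abs//.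
by case/andP: (pK k).
Qed.

Lemma sum_box (V : nmodType) K (F : Zd -> V) :
  \sum_(p <- box K) F p = \sum_(g : {ffun 'I_d -> 'I_K}) F (lattice_point g).
Proof.
rewrite big_imfset/=; first by rewrite big_enum.
by move=> g h _ _; exact: lattice_point_inj.
Qed.

(** The ratio of the volumes of consecutive cubes, [(q.+2 / q.+1) ^ d], tends to 1. *)
Lemma natr_pow_limit (s c : R) : 0 <= c ->
  (forall q : nat, q.+1%:R ^+ d * s <= c * q.+2%:R ^+ d) -> s <= c.
Proof.
move=> c0 h; have lim : (c * (1 + q.+1%:R^-1) ^+ d) @[q --> \oo] --> c.
  rewrite -[X in _ --> X]mulr1 -[X in _ * X](expr1n _ d).
  apply: cvgM; first exact: cvg_cst.
  have l1 : (1 + q.+1%:R^-1) @[q --> \oo] --> (1 : R).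
    by rewrite -[X in _ --> X]addr0; apply: cvgD; [exact: cvg_cst|exact: cvg_harmonic].
  exact: (cvg_comp _ _ l1 (@exprn_continuous R d 1)).
apply: (cvgr_to_ge lim); apply: nearW => q.
have q0 : 0 < q.+1%:R ^+ d :> R by rewrite exprn_gt0.
rewrite -(ler_pM2l q0); apply: le_trans (h q) _.
rewrite mulrCA -exprMn mulrDr mulr1 mulfV ?pnatr_eq0//.
by rewrite -natr1.
Qed.

(* Apply the operator to the indicator of a box: on a slightly smaller box it
   is the constant [\sum_i b i]. *)
Lemma polynomial_augmentation_le (I : finType) (f : I -> Zd) (b : I -> C) (c : R) :
  op_bound (\sum_i b i *: monomial T0 (f i)) c -> normsq (\sum_i b i) <= c ^+ 2.
Proof.
move=> [_ c0 yc]; set y := \sum_i _ in yc.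
pose M := (\max_i \max_k `|f i 0%R k|%N).+1.
have fM i k : (`|f i 0%R k| < M)%N.
  rewrite ltnS; apply: leq_trans (leq_bigmax_cond (P := predT) i isT).
  exact: (leq_bigmax_cond (P := predT) (F := fun k => `|f i 0%R k|%N) k isT).
pose shift : Zd := const_mx M%:Z.
apply: natr_pow_limit => [|q]; first exact: sqr_ge0.
(* [K] exceeds [L] by [2 * M], a margin of [M] on either side, so subtracting any [f i] from the
   shifted inner cube stays in [box K]. The common factor [2 * M] cancels at the end. *)
pose L := (2 * M * q.+1)%N; pose K := (2 * M * q.+2)%N.
have KL : K = (L + 2 * M)%N by rewrite /K /L mulnS addnC.
pose chi : H := fcomb (box K) (fun=> 1).
have card K' : \sum_(p <- box K') (1 : R) = K'%:R ^+ d.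
  by rewrite sum_box sumr_const card_ffun !card_ord natrX.
have chiN : N2 chi = K%:R ^+ d.
  rewrite N2_fcomb -card; apply: eq_bigr => p _.
  by rewrite /normsq/= expr1n expr0n addr0.
have ychi (g : {ffun 'I_d -> 'I_L}) : y chi (lattice_point g + shift) = \sum_i b i.
  rewrite /y op_sumE l2_sum; apply: eq_bigr => i _.
  transitivity (b i * monomial T0 (f i) chi (lattice_point g + shift)) => //.
  rewrite monomial0E fcombE in_box ?mulr1// => k; rewrite !mxE KL.
  have := fM i k; have := ltn_ord (g k); move: (f i 0 k) (nat_of_ord (g k)) => z j.
  lia.
have h : L%:R ^+ d * normsq (\sum_i b i) <= c ^+ 2 * K%:R ^+ d.
  rewrite -chiN; apply: le_trans (yc chi).
  pose sh (g : {ffun 'I_d -> 'I_L}) : Zd := lattice_point g + shift.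
  pose B : {fset Zd} := [fset sh g | g in {: {ffun 'I_d -> 'I_L}}]%fset.
  apply: le_trans (N2_ge _ B); rewrite big_imfset/=; last first.
    by move=> g1 g2 _ _ /addIr; exact: lattice_point_inj.
  rewrite big_enum/= (eq_bigr (fun=> normsq (\sum_i b i))) => [|g _];
    last by rewrite ychi.
  by rewrite sumr_const card_ffun !card_ord -[leRHS]mulr_natl natrX.
have M0 : 0 < (2 * M)%:R ^+ d :> R by rewrite exprn_gt0// ltr0n muln_gt0.
rewrite -(ler_pM2l M0) mulrA -exprMn -natrM -/L.
by apply: le_trans h _; rewrite mulrCA -exprMn -natrM.
Qed.

Lemma map_norm_schur_bound phi S (c : R) : 0 <= c ->
  extends_multiplier T0 phi S -> (map_norm (Linf T0) S <= c%:E)%E ->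
  schur_bound (toeplitz phi) c.
Proof.
move=> c0 ext Sc I r a ac v; have [SL Sl _ _] := ext.
(* The functional is tested on the image vector itself: the coefficients of [S x] then sum to [W],
   and [W ^+ 2 <= c ^+ 2 * (V * W)] is the claim after cancelling [W]. *)
pose w i := \sum_j toeplitz phi (r i) (r j) * a i j * v j.
pose V := \sum_j normsq (v j); pose W := \sum_i normsq (w i); rewrite -/V -/W.
have V0 : 0 <= V by apply: sumr_ge0 => j _; exact: normsq_ge0.
have W0 : 0 <= W by apply: sumr_ge0 => j _; exact: normsq_ge0.
pose f (e : I * I) := r e.1 - r e.2.
pose b (e : I * I) := a e.1 e.2 * v e.2 * conjc (w e.1).
pose x := \sum_e b e *: monomial T0 (f e).
have px : polynomials T0 x by rewrite /x; exact: polynomials_sum.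
have xb := polynomials_bounded px.
(* [x] factors as the row [conjc (w i) * U^(r i)], the matrix [a] and the column [v j * U^(- r j)];
   the monomials commute here, without phases. *)
have xVW xi : N2 (x xi) <= V * W * N2 xi.
  pose F j : H := wshift (fun=> 0) (- r j) xi.
  have FE j p : F j p = xi (p + r j) by rewrite wshiftE expi0 mul1r opprK.
  pose G i : H := \sum_j a i j *: (v j *: F j).
  have xE p : x xi p = \sum_i conjc (w i) * G i (p - r i).
    rewrite /x op_sumE l2_sum (eq_bigr (fun e : I * I =>
      conjc (w e.1) * (a e.1 e.2 * (v e.2 * F e.2 (p - r e.1))))); last first.
      move=> e _.
      transitivity (b e * monomial T0 (f e) xi p) => //.
      rewrite monomial0E FE /b /f opprB addrA [p + _ - _]addrAC.
      by ring.
    rewrite -(pair_bigA _ (fun i j => conjc (w i) * (a i j * (v j * F j (p - r i)))))/=.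
    by apply: eq_bigr => i _; rewrite /G l2_sum -mulr_sumr.
  pose G' i : H := wshift (fun=> 0) (r i) (G i).
  have G'E i p : G' i p = G i (p - r i) by rewrite wshiftE expi0 mul1r.
  have xG : N2 (x xi) <= W * \sum_i N2 (G' i).
    apply: (has_sum_le (N2_has_sum _) (has_sumZ W (has_sum_sum _ (fun i => N2_has_sum
      (G' i))))) => p.
    rewrite xE; apply: le_trans (normsq_sumM _ _ _) _.
    rewrite (eq_bigr (fun i => normsq (w i))) => [|i _]; last by rewrite normsq_conj.
    by under [in leRHS]eq_bigr do rewrite G'E.
  apply: le_trans xG _; rewrite [V * W]mulrC -mulrA ler_wpM2l//.
  under eq_bigr do rewrite N2_wshift.
  apply: le_trans (contraction_l2 _ ac) _.
  by rewrite /V mulr_suml; apply: ler_sum => j _; rewrite N2Z N2_wshift.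
have SxE : S x = \sum_e (toeplitz phi (r e.1) (r e.2) * b e) *: monomial T0 (f e).
  apply: bounded_op_ext => [||m n]; first exact/Linf_bounded/SL/polynomials_Linf.
    by apply: bounded_op_sum => e; exact: monomial_bounded.
  rewrite (extension_polynomial_entry _ _ ext)// /x !op_sumE !l2_sum mulr_sumr.
  apply: eq_bigr => e _.
  transitivity (toeplitz phi m n * (b e * monomial T0 (f e) (delta R n) m)) => //.
  transitivity (toeplitz phi (r e.1) (r e.2) * b e * monomial T0 (f e) (delta R n) m)
    => //.
  rewrite monomial_entry; case: eqVneq => [->|_]; last by rewrite !mulr0.
  by rewrite /toeplitz addrK !mulrA.
have sumW : \sum_e toeplitz phi (r e.1) (r e.2) * b e = W%:C.
  rewrite (eq_bigr (fun e : I * I => conjc (w e.1) *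
      (toeplitz phi (r e.1) (r e.2) * a e.1 e.2 * v e.2))); last first.
    by move=> e _; rewrite /b; ring.
  rewrite -(pair_bigA _ (fun i j => conjc (w i) * (toeplitz phi (r i) (r j) * a i j * v
    j)))/=.
  rewrite rmorph_sum/=; apply: eq_bigr => i _.
  by rewrite -mulr_sumr -/(w i) mulrC mul_conjc.
(* A positive [s] is needed to normalize [x]. If [V * W] is 0, arbitrarily small [s] force [W = 0];
   otherwise [s] is its square root. *)
suff h : forall s : R, 0 < s -> V * W <= s ^+ 2 -> W ^+ 2 <= (c * s) ^+ 2.
  have [VW|VW] := leP (V * W) 0.
    suff -> : W = 0 by rewrite mulr_ge0 ?sqr_ge0.
    apply/eqP; rewrite -sqrf_eq0 eq_le sqr_ge0 andbT; apply/ler_addgt0Pr => e e0.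
    pose s := Num.sqrt (e / (c ^+ 2 + 1)).
    have c1 : 0 < c ^+ 2 + 1 by rewrite ltr_wpDl ?sqr_ge0.
    have s0 : 0 < s by rewrite sqrtr_gt0 divr_gt0.
    have := h s s0 (le_trans VW (sqr_ge0 _)).
    rewrite exprMn sqr_sqrtr; last by apply: divr_ge0; exact: ltW.
    move=> /le_trans; apply.
    by rewrite add0r mulrA ler_pdivrMr// mulrC ler_wpM2l ?ltW// ltrDl.
  have W1 : 0 < W.
    by rewrite lt_def W0 andbT; apply: contraTneq VW => ->; rewrite mulr0 ltxx.
  have s0 : 0 < Num.sqrt (V * W) by rewrite sqrtr_gt0.
  have := h _ s0; rewrite sqr_sqrtr ?(ltW VW)// => /(_ (lexx _)).
  by rewrite exprMn sqr_sqrtr ?(ltW VW)// mulrA expr2 ler_pM2r.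
move=> s s0 VWs.
have sC : s%:C != 0 :> C by rewrite eq_complex /= eqxx andbT gt_eqF.
have xs : op_bound x s.
  split; [exact: bounded_op_linear|exact: ltW|] => xi.
  by apply: le_trans (xVW xi) _; rewrite ler_wpM2r ?N2_ge0.
pose z := s%:C^-1 *: x.
have pz : polynomials T0 z.
  rewrite /z /x scaler_sumr; under eq_bigr do rewrite scalerA.
  exact: polynomials_sum.
have z1 : (opnorm z <= 1%:E)%E.
  apply: op_bound_opnorm; split => //; first exact: (bounded_op_linear
    (polynomials_bounded pz)).
  move=> xi; rewrite -[z xi]/(s%:C^-1 *: x xi) N2Z expr1n mul1r.
  have -> : normsq (s%:C^-1 : C) = (s ^+ 2)^-1.
    by rewrite -rmorphV ?unitfE ?gt_eqF//= normsq_real exprVn.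
  by rewrite ler_pdivrMl ?exprn_gt0//; have [_ _] := xs; apply.
have Szc : op_bound (S z) c.
  apply: opnorm_op_bound; first exact/bounded_op_linear/Linf_bounded/SL/polynomials_Linf.
  apply: le_trans Sc; apply: ereal_sup_ubound; exists z => //; split => //.
  exact: polynomials_Linf.
have Szx : S z = \sum_e (s%:C^-1 * (toeplitz phi (r e.1) (r e.2) * b e)) *: monomial T0
  (f e).
  have S0 : S 0 = 0.
    have p0 : Linf T0 0.
      apply: polynomials_Linf; have := polynomials_sum T0 (Nil Zd) id (fun=> 0).
      by rewrite big_nil.
    have := Sl 1 0 0 p0 p0; rewrite !scale1r addr0 => e.
    by apply: (@addrI _ (S 0)); rewrite -e addr0.
  have p0 : Linf T0 0.
    apply: polynomials_Linf; have := polynomials_sum T0 (Nil Zd) id (fun=> 0).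
    by rewrite big_nil.
  have := Sl s%:C^-1 x 0 (polynomials_Linf px) p0; rewrite S0 !addr0 -/z => ->.
  by rewrite SxE scaler_sumr; apply: eq_bigr => e _; rewrite scalerA.
rewrite Szx in Szc; have := polynomial_augmentation_le Szc.
rewrite -mulr_sumr sumW normsqM normsq_real.
have -> : normsq (s%:C^-1 : C) = (s ^+ 2)^-1.
  by rewrite -rmorphV ?unitfE ?gt_eqF//= normsq_real exprVn.
by rewrite ler_pdivrMl ?exprn_gt0// exprMn mulrC.
Qed.

End Torus.

(** * From the Schur bound back to multipliers *)

Section SchurToMultiplier.
Variables (R : realType) (d : nat) (theta : 'M[R]_d).
Local Notation Zd := 'rV[int]_d.
Local Notation H := (l2 R Zd).
Local Notation C := R[i].
Implicit Types (x y : H -> H) (phi : Zd -> C) (S : (H -> H) -> H -> H).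

Lemma schur_polynomial phi (c : R) (s : seq Zd) (a : Zd -> C) : 0 <= c ->
  schur_bound (toeplitz phi) c ->
  schur (toeplitz phi) (\sum_(m <- s) a m *: monomial theta m) =
  \sum_(m <- s) (phi m * a m) *: monomial theta m.
Proof.
move=> c0 phic; have xb b : bounded_op (\sum_(m <- s) b m *: monomial theta m).
  by apply: bounded_op_sum => m; exact: monomial_bounded.
apply: bounded_op_ext;
  [exact: (schur_bounded c0 phic (xb a))|exact: (xb (fun m => phi m * a m))|move=> q n].
rewrite (schur_delta phic)// !op_sumE !l2_sum mulr_sumr; apply: eq_bigr => m _.
transitivity (toeplitz phi q n * (a m * monomial theta m (delta R n) q)) => //.
transitivity (phi m * a m * monomial theta m (delta R n) q) => //.
rewrite monomial_entry; case: eqVneq => [->|_]; last by rewrite !mulr0.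
by rewrite /toeplitz addrK !mulrA.
Qed.

Lemma schur_extends_multiplier phi (c : R) : 0 <= c ->
  schur_bound (toeplitz phi) c ->
  extends_multiplier theta phi (schur (toeplitz phi)).
Proof.
move=> c0 phic.
have SP x : polynomials theta x -> polynomials theta (schur (toeplitz phi) x).
  move=> [s [a ->]]; rewrite (schur_polynomial s a c0 phic).
  exact: (polynomials_sum theta s id).
split.
- move=> x; apply: (schur_wstar_closure c0 phic); first exact: Atheta_bounded.
  move=> y; apply: (schur_norm_closure c0 phic) => //; exact: polynomials_bounded.
- move=> a x y /Linf_bounded xb /Linf_bounded yb.
  exact: (schur_linear_comb c0 phic).
- apply: continuous_subspaceW (schur_wstar_continuous c0 phic).
  exact: Linf_bounded.
- move=> x px; split; first exact: SP.
  move=> m; rewrite !fourier_coefE (schur_delta phic) ?/toeplitz ?subr0//.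
  exact: polynomials_bounded px.
Qed.

(** By [extension_entry] any extension has the entries of the Schur multiplier on all of [Linf],
    which is what [schur_entries_bound] asks for. *)
Lemma schur_bound_cb_norm phi S (c : R) : 0 <= c ->
  extends_multiplier theta phi S -> schur_bound (toeplitz phi) c ->
  (cb_norm (Linf theta) S <= c%:E)%E.
Proof.
move=> c0 ext phic; have [SL _ _ _] := ext.
apply: ge_ereal_sup => _ [n _] <-; apply: ge_ereal_sup => _ [X [XL X1]] <-.
have Xb i j : bounded_op (X i j) by exact: Linf_bounded (XL i j).
have Yb i j : bounded_op (map_mx S X i j).
  by rewrite mxE; exact/Linf_bounded/SL.
apply/mx_opnorm_leP => // [i j|xi]; first exact: bounded_op_linear.
rewrite -[c]mulr1.
apply: (@schur_entries_bound _ _ (toeplitz phi) c phic _ X (map_mx S X) 1 Xb Yb _ ltr01).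
  by move=> i j m q; rewrite mxE (extension_entry _ _ ext).
by move: X1 => /(mx_opnorm_leP (fun i j => bounded_op_linear (Xb i j)) ler01).
Qed.

Lemma Linf0 : Linf theta 0.
Proof.
apply: polynomials_Linf; have := polynomials_sum theta (Nil 'rV[int]_d) id (fun=> 0).
by rewrite big_nil.
Qed.

Lemma opnorm0 : opnorm (0 : H -> H) = 0%E.
Proof.
apply/eqP; rewrite eq_le opnorm_ge0 andbT; apply: op_bound_opnorm.
split => //; first exact: bounded_op_linear (bounded_op0 _ _).
by move=> xi; rewrite -[(0 : H -> H) xi]/(0 : H) N2_0 expr0n mul0r.
Qed.

Lemma map_norm_ge0 S : (0 <= map_norm (Linf theta) S)%E.
Proof.
apply: le_trans (opnorm_ge0 (S 0)) _; apply: ereal_sup_ubound; exists 0 => //.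
by split; [exact: Linf0|rewrite opnorm0 lee_fin ler01].
Qed.

Lemma map_norm_le_cb_norm S : (forall x, Linf theta x -> Linf theta (S x)) ->
  (map_norm (Linf theta) S <= cb_norm (Linf theta) S)%E.
Proof.
move=> SL; apply: (@le_trans _ _ (amplification_norm (Linf theta) S 1)); last first.
  by apply: ereal_sup_ubound; exists 0%N.
have E x : mx_opnorm (const_mx x : 'M[H -> H]_1) = opnorm x.
  rewrite /mx_opnorm /opnorm.
  have N (xi : 'I_1 -> H) : l2norm_n xi = l2norm (xi ord0).
    by rewrite /l2norm_n big_ord1 sqrtr_sqr ger0_norm// sqrtr_ge0.
  have A (xi : 'I_1 -> H) : mx_act (const_mx x) xi ord0 = x (xi ord0).
    by rewrite /mx_act big_ord1 mxE.
  congr ereal_sup; apply/seteqP; split => _ [xi /= xi1] <-.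
    by exists (xi ord0); [rewrite /= -N|rewrite N A].
  by exists (fun=> xi); [rewrite /= N|rewrite N A].
apply: ge_ereal_sup => _ [x [Lx x1]] <-; apply: ereal_sup_ubound.
exists (const_mx x); last by rewrite -(E (S x)); congr mx_opnorm; apply/matrixP => i j;
  rewrite !mxE.
by split => [i j|]; rewrite ?mxE ?E.
Qed.

Lemma cb_norm_ge0 S : (forall x, Linf theta x -> Linf theta (S x)) ->
  (0 <= cb_norm (Linf theta) S)%E.
Proof. by move=> SL; apply: le_trans (map_norm_ge0 S) (map_norm_le_cb_norm SL). Qed.

Lemma finite_cb_norm_schur_bound phi S : extends_multiplier theta phi S ->
  (cb_norm (Linf theta) S < +oo)%E -> exists2 c : R, 0 <= c &
    cb_norm (Linf theta) S = c%:E /\ schur_bound (toeplitz phi) c.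
Proof.
move=> ext Soo; have [SL _ _ _] := ext; have S0 := cb_norm_ge0 SL.
exists (fine (cb_norm (Linf theta) S)); first exact: fine_ge0.
have E : cb_norm (Linf theta) S = (fine (cb_norm (Linf theta) S))%:E.
  by rewrite fineK// ge0_fin_numE.
by split => //; apply: (cb_norm_schur_bound _ ext); rewrite -?E ?fine_ge0.
Qed.

Lemma multiplier_map_extends phi S : extends_multiplier theta phi S ->
  extends_multiplier theta phi (multiplier_map theta phi).
Proof.
by move=> ext; apply: xgetPex; exists S.
Qed.

End SchurToMultiplier.

(** The Schur bound forgets [theta]. With [theta' = theta] the statement compares two extensions of
    the same [T_phi]. *)
Lemma cb_norm_transference (R : realType) (d : nat) (theta theta' : 'M[R]_d)
    (phi : 'rV[int]_d -> R[i]) S S' :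
  extends_multiplier theta phi S -> extends_multiplier theta' phi S' ->
  (cb_norm (Linf theta) S < +oo)%E ->
  (cb_norm (Linf theta') S' <= cb_norm (Linf theta) S)%E.
Proof.
move=> ext ext' /(finite_cb_norm_schur_bound ext)[c c0 [-> phic]].
exact: (schur_bound_cb_norm c0 ext').
Qed.

Lemma cb_multipliers_transference (R : realType) (d : nat) (theta theta' : 'M[R]_d) :
  cb_multipliers theta `<=` cb_multipliers theta'.
Proof.
move=> phi [S [ext Soo]].
have [c c0 [_ phic]] := finite_cb_norm_schur_bound ext Soo.
exists (schur (toeplitz phi)); have ext' := schur_extends_multiplier theta' c0 phic.
split; first exact: ext'.
exact: le_lt_trans (cb_norm_transference ext ext' Soo) Soo.
Qed.

Lemma multipliers_torus_cb_norm (R : realType) (d : nat) (phi : 'rV[int]_d -> R[i]) S :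
  extends_multiplier (0 : 'M[R]_d) phi S ->
  (map_norm (Linf (0 : 'M[R]_d)) S < +oo)%E ->
  (cb_norm (Linf (0 : 'M[R]_d)) S <= map_norm (Linf (0 : 'M[R]_d)) S)%E.
Proof.
move=> ext Soo; set c := fine (map_norm (Linf (0 : 'M[R]_d)) S).
have E : map_norm (Linf (0 : 'M[R]_d)) S = c%:E.
  by rewrite fineK// ge0_fin_numE// map_norm_ge0.
have c0 : 0 <= c by rewrite fine_ge0// map_norm_ge0.
rewrite E; apply: (schur_bound_cb_norm c0 ext).
by apply: (map_norm_schur_bound c0 ext); rewrite E.
Qed.

Theorem proposition7p2 (R : realType) (d : nat) (theta : 'M[R]_d)
    (d_ge2 : (2 <= d)%N) (theta_skew : theta^T = - theta) :
  [/\ cb_multipliers theta = cb_multipliers (0 : 'M[R]_d),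
      cb_multipliers (0 : 'M[R]_d) = multipliers (0 : 'M[R]_d),
      forall phi, cb_multipliers theta phi ->
        cb_multiplier_norm theta phi = cb_multiplier_norm (0 : 'M[R]_d) phi &
      forall phi, cb_multipliers (0 : 'M[R]_d) phi ->
        cb_multiplier_norm (0 : 'M[R]_d) phi
        = multiplier_norm (0 : 'M[R]_d) phi].
Proof.
(* Membership provides some extension [S], whereas the norm is that of the chosen [multiplier_map];
   transference from [theta'] to itself passes finiteness from one to the other. *)
have unique_norm (theta' : 'M[R]_d) phi S : extends_multiplier theta' phi S ->
    (cb_norm (Linf theta') S < +oo)%E ->
    extends_multiplier theta' phi (multiplier_map theta' phi) /\
    (cb_multiplier_norm theta' phi < +oo)%E.
  move=> ext Soo; have ext' := multiplier_map_extends ext; split; first exact: ext'.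
  exact: le_lt_trans (cb_norm_transference ext ext' Soo) Soo.
split.
- by apply/seteqP; split; exact: cb_multipliers_transference.
- apply/seteqP; split=> phi [S [ext Soo]]; exists S; (split; first exact: ext).
    by have [SL _ _ _] := ext; apply: le_lt_trans (map_norm_le_cb_norm SL) Soo.
  exact: le_lt_trans (multipliers_torus_cb_norm ext Soo) Soo.
- move=> phi phi_theta; have [S [ext Soo]] := phi_theta.
  have [S' [ext' Soo']] := @cb_multipliers_transference R d theta 0 _ phi_theta.
  have [e1 l1] := unique_norm _ _ _ ext Soo; have [e2 l2] := unique_norm _ _ _ ext' Soo'.
  apply: le_anti; apply/andP; split.
    exact: cb_norm_transference e2 e1 l2.
  exact: cb_norm_transference e1 e2 l1.
- move=> phi [S [ext Soo]]; have [e1 l1] := unique_norm _ _ _ ext Soo.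
  have [SL _ _ _] := e1.
  have le1 := map_norm_le_cb_norm SL.
  apply: le_anti; apply/andP; split; last exact: le1.
  apply: multipliers_torus_cb_norm; first exact: e1.
  exact: le_lt_trans le1 l1.
Qed.
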